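(* Let $m\ge 1$ and $0<\alpha\le 1$. Suppose that the functional $$I^{m}[q(\cdot)]=\frac{1}{\Gamma(\alpha)}\int_a^t L\left(\theta,q(\theta),\dot q(\theta),\ldots,q^{(m)}(\theta)\right)(t-\theta)^{\alpha-1}\,d\theta$$ is invariant (with gauge term $\Lambda$, in the sense defined in the context) under the infinitesimal transformations with generators $\tau(\theta,q)\in\mathbb{R}$ and $\xi(\theta,q)\in\mathbb{R}^n$, and that $\tau$ and $\xi$ satisfy the condition $$G\left(\theta,q(\theta),\dot q(\theta),\ldots,q^{(2m-1)}(\theta)\right)\cdot\Omega=-L\left(\theta,q(\theta),\dot q(\theta),\ldots,q^{(m)}(\theta)\right)\tau ,$$ where $\Omega=\xi-\dot q\,\tau$ and $$G=\sum_{i=1}^{m}(-1)^{i-1}\,i\,\frac{d^{i-1}}{d\theta^{i-1}}\partial_{i+2}L+\sum_{k=2}^{m}\sum_{i=2}^{k}(-1)^{i-1}\frac{\Gamma(i-\alpha+1)}{\Gamma(2-\alpha)(t-\theta)^{i-1}}\binom{k}{k-i}\frac{d^{k-i}}{d\theta^{k-i}}\partial_{k+2}L ,$$ with $L$ and its partial derivatives evaluated at $(\theta,q(\theta),\dot q(\theta),\ldots,q^{(m)}(\theta))$. Then $$C\left(\theta,q(\theta),\dot q(\theta),\ldots,q^{(2m-1)}(\theta)\right)=\sum_{j=1}^{m}\psi^{j}\cdot\rho^{j-1}+\left(L-\sum_{j=1}^{m}\psi^{j}\cdot q^{(j)}(\theta)\right)\tau-\Lambda\left(\theta,q(\theta),\dot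 q(\theta),\ldots,q^{(2m-1)}(\theta)\right)$$ is a conservation law, i.e. $\frac{d}{d\theta}C\left(\theta,q(\theta),\ldots,q^{(2m-1)}(\theta)\right)=0$ along all solutions $q(\cdot)$ of the higher-order Euler-Lagrange equation $$\sum_{i=0}^{m}(-1)^{i}\frac{d^{i}}{d\theta^{i}}\partial_{i+2}L\left(\theta,q(\theta),\ldots,q^{(m)}(\theta)\right)=F\left(\theta,q(\theta),\ldots,q^{(2m-1)}(\theta)\right),$$ where $\psi^j$, $\rho^{j}$ and $F$ are as defined in the context.
   Context: Setting. $a<t\le b$ are real numbers; $\theta$ (intrinsic time) ranges over values $a\le\theta<t$, while $t$ (observer time) is fixed; $\Gamma$ is the Euler gamma function; $n,m\ge1$ are integers. The Lagrangian $L:[a,b]\times\mathbb{R}^{n\times(m+1)}\to\mathbb{R}$ is of class $C^{2m}$ in all its arguments. Curves $q(\cdot)$ take values in $\mathbb{R}^n$ and are sufficiently smooth (at least $C^{2m}$); $q^{(i)}$ is the $i$-th derivative of $q$, $q^{(0)}=q$, and a dot denotes $d/d\theta$, the total derivative along $q$. $\partial_i L$ is the partial derivative (gradient) of $L(\cdot,\ldots,\cdot)$ with respect to its $i$-th argument, so $\partial_1L$ is the derivative in $\theta$ and $\partial_{i+2}L\in\mathbb{R}^n$ is the gradient in $q^{(i)}$, $i=0,\ldots,m$. The symbol $\cdot$ between vectors is the inner product of $\mathbb{R}^n$. Function $F$: $$F=\frac{1-\alpha}{t-\theta}\sum_{i=1}^{m}i(-1)^{i-1}\frac{d^{i-1}}{d\theta^{i-1}}\partial_{i+2}L+\sum_{k=2}^{m}\sum_{i=2}^{k}(-1)^{i-1}\frac{\Gamma(i-\alpha+1)}{(t-\theta)^{i}\,\Gamma(1-\alpha)}\binom{k}{k-i}\frac{d^{k-i}}{d\theta^{k-i}}\partial_{k+2}L,$$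 with $L$ evaluated at $(\theta,q(\theta),\ldots,q^{(m)}(\theta))$, and with $1/\Gamma(1-\alpha)$ read as $0$ when $\alpha=1$. Functions $\psi^j$: $$\psi^{j}=\sum_{i=0}^{m-j}(-1)^{i}\frac{d^{i}}{d\theta^{i}}\partial_{i+j+2}L\left(\theta,q(\theta),\ldots,q^{(m)}(\theta)\right),\qquad j=1,\ldots,m.$$ Functions $\rho^i$: $\rho^0=\xi$ and $\rho^{i}=\frac{d}{d\theta}\left(\rho^{i-1}\right)-q^{(i)}(\theta)\,\dot\tau$ for $i=1,\ldots,m$. Invariance. The infinitesimal transformations are $$\bar\theta=\theta+\varepsilon\tau(\theta,q)+o(\varepsilon),\qquad \bar q(\bar\theta)=q(\theta)+\varepsilon\xi(\theta,q)+o(\varepsilon),$$ with $\tau,\xi$ sufficiently smooth and the $o(\varepsilon)$ terms sufficiently smooth in $\theta$ with $\theta$-derivatives that are again $o(\varepsilon)$. The functional $I^m$ is invariant under these transformations (with gauge term $\Lambda=\Lambda(\theta,q,\dot q,\ldots,q^{(2m-1)})$, a differentiable real function) if, for all such curves $q$, $$L\left(\bar\theta,\bar q(\bar\theta),\bar q'(\bar\theta),\ldots,\bar q'^{(m)}(\bar\theta)\right)(t-\bar\theta)^{\alpha-1}\frac{d\bar\theta}{d\theta}=L\left(\theta,q(\theta),\dot q(\theta),\ldots,q^{(m)}(\theta)\right)(t-\theta)^{\alpha-1}+\varepsilon(t-\theta)^{\alpha-1}\frac{d\Lambda}{d\theta}\left(\theta,q(\theta),\ldots,q^{(2m-1)}(\theta)\right)+o(\varepsilon),$$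 where $\bar q'=\frac{d\bar q}{d\bar\theta}=\frac{d\bar q/d\theta}{d\bar\theta/d\theta}$ and $\bar q'^{(i)}=\frac{d^i\bar q}{d\bar\theta^i}=\frac{\frac{d}{d\theta}\left(\frac{d^{i-1}\bar q}{d\bar\theta^{i-1}}\right)}{d\bar\theta/d\theta}$ for $i=2,\ldots,m$. The condition $G\cdot\Omega=-L\tau$ is likewise understood as an identity along all such curves $q$. *)

(* Defs.v *)
From mathcomp Require Import all_boot all_order all_algebra.
From mathcomp Require Import all_classical all_reals all_analysis.

Set Implicit Arguments.
Unset Strict Implicit.
Unset Printing Implicit Defensive.

Import Order.TTheory GRing.Theory Num.Theory.
Import numFieldNormedType.Exports.

Local Open Scope ring_scope.
Local Open Scope classical_set_scope.

(* Euler's integral; the value is meaningful for 0 < x only. *)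
Definition Gamma (R : realType) (x : R) : R :=
  \int[@lebesgue_measure R]_(u in `]0%R, +oo[) (u `^ (x - 1) * expR (- u)).

(* Inner product of R^n, written out because the norm of 'cV_n in the library
   is the sup norm. *)
Definition dotv (R : realType) (n : nat) (u v : 'cV[R]_n) : R :=
  \sum_(k < n) u k ord0 * v k ord0.

(* f is of class C^k on a neighbourhood of x: Frechet differentiable, with
   iterated directional derivatives that are again differentiable, up to order
   k, those of order k being continuous.  Functions on [a, b] (or on
   [a, b] x R^N) are represented by total functions that are C^k around every
   point of that set, so that the two-sided derivatives at an end point are the
   one-sided ones of the restriction. *)
Fixpoint Ck_at (R : realType) (V W : normedModType R) (k : nat)
    (f : V -> W) (x : V) : Prop :=
  match k with
  | 0 => \forall y \near x, {for y, continuous f}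
  | k'.+1 => (\forall y \near x, differentiable f y) /\
             forall v : V, Ck_at k' (fun y => 'D_v f y) x
  end.

(* f(eps) = o(eps) as eps -> 0, eps <> 0, along the eps in D. *)
Definition is_o_eps (R : realType) (V : normedModType R) (D : set R)
    (f : R -> V) : Prop :=
  let F := within D (dnbhs (0 : R)) in f =o_F (@id R).

Definition curve_C (R : realType) (n k : nat) (a b : R)
    (q : R -> 'cV[R]_n) : Prop :=
  forall s, a <= s <= b -> Ck_at k q s.

(* Column j is q^(j)(s), for 0 <= j < k. *)
Definition jet (R : realType) (n k : nat) (q : R -> 'cV[R]_n) (s : R) :
    'M[R]_(n, k) :=
  \matrix_(r < n, j < k) derive1n j q s r ord0.

Section LagrangianAlongCurve.
Context (R : realType) (n m : nat).
Variable L : R * 'M[R]_(n, m.+1) -> R.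

(* The gradient of L in its matrix column i <= m, that is with respect to
   q^(i): this is partial_{i+2} L. *)
Definition gradL (i : nat) (p : R * 'M[R]_(n, m.+1)) : 'cV[R]_n :=
  \col_(k < n) 'D_((0, delta_mx k (inord i)) : R * 'M[R]_(n, m.+1)) L p.

Variable q : R -> 'cV[R]_n.

Definition Lq (s : R) : R := L (s, jet m.+1 q s).

Definition gradLq (i : nat) (s : R) : 'cV[R]_n := gradL i (s, jet m.+1 q s).

Definition EL_lhs (s : R) : 'cV[R]_n :=
  \sum_(0 <= i < m.+1) (-1) ^+ i *: derive1n i (gradLq i) s.

Definition EL_F (alpha t s : R) : 'cV[R]_n :=
  ((1 - alpha) / (t - s)) *:
    (\sum_(1 <= i < m.+1) (i%:R * (-1) ^+ i.-1) *: derive1n i.-1 (gradLq i) s)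
  + \sum_(2 <= k < m.+1) \sum_(2 <= i < k.+1)
      ((-1) ^+ i.-1 *
       (Gamma (i%:R - alpha + 1) / (t - s) ^+ i *
        (if alpha == 1 then 0 else (Gamma (1 - alpha))^-1)) *
       'C(k, k - i)%:R) *: derive1n (k - i) (gradLq k) s.

Definition cond_G (alpha t s : R) : 'cV[R]_n :=
  \sum_(1 <= i < m.+1) ((-1) ^+ i.-1 * i%:R) *: derive1n i.-1 (gradLq i) s
  + \sum_(2 <= k < m.+1) \sum_(2 <= i < k.+1)
      ((-1) ^+ i.-1 *
       (Gamma (i%:R - alpha + 1) / (Gamma (2 - alpha) * (t - s) ^+ i.-1)) *
       'C(k, k - i)%:R) *: derive1n (k - i) (gradLq k) s.

Definition psi (j : nat) (s : R) : 'cV[R]_n :=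
  \sum_(0 <= i < (m - j).+1) (-1) ^+ i *: derive1n i (gradLq (i + j)) s.

Variables (tau : R * 'cV[R]_n -> R) (xi : R * 'cV[R]_n -> 'cV[R]_n).

Definition tauq (s : R) : R := tau (s, q s).

Definition xiq (s : R) : 'cV[R]_n := xi (s, q s).

Definition Omega (s : R) : 'cV[R]_n := xiq s - tauq s *: derive1 q s.

Fixpoint rho (i : nat) : R -> 'cV[R]_n :=
  match i with
  | 0 => xiq
  | j.+1 => fun s => derive1 (rho j) s - derive1 tauq s *: derive1n j.+1 q s
  end.

Definition noetherC (Lam : R * 'M[R]_(n, m.*2) -> R) (s : R) : R :=
  \sum_(1 <= j < m.+1) dotv (psi j s) (rho j.-1 s)
  + (Lq s - \sum_(1 <= j < m.+1) dotv (psi j s) (derive1n j q s)) * tauq s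
  - Lam (s, jet m.*2 q s).

End LagrangianAlongCurve.

Section Transformations.
Context (R : realType) (n : nat).
(* A one-parameter family of point transformations
   (theta, q) |-> (thb eps (theta, q), qb eps (theta, q)). *)
Variables (thb : R -> R * 'cV[R]_n -> R) (qb : R -> R * 'cV[R]_n -> 'cV[R]_n).

Definition thbq (q : R -> 'cV[R]_n) (e s : R) : R := thb e (s, q s).

Definition qbq (q : R -> 'cV[R]_n) (e s : R) : 'cV[R]_n := qb e (s, q s).

(* The o(eps) terms of the transformation, along a curve. *)
Definition rem_th (tau : R * 'cV[R]_n -> R) (q : R -> 'cV[R]_n) (e s : R) : R :=
  thbq q e s - (s + e * tau (s, q s)).

Definition rem_q (xi : R * 'cV[R]_n -> 'cV[R]_n) (q : R -> 'cV[R]_n) (e s : R) :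
    'cV[R]_n :=
  qbq q e s - (q s + e *: xi (s, q s)).

(* The family has generators tau and xi: along every C^2m curve the remainders
   are C^m in theta for small eps, and they and their theta-derivatives up to
   order m (the highest order entering the invariance identity) are o(eps). *)
Definition has_generators (m : nat) (a b t : R) (tau : R * 'cV[R]_n -> R)
    (xi : R * 'cV[R]_n -> 'cV[R]_n) : Prop :=
  forall q : R -> 'cV[R]_n, curve_C m.*2 a b q ->
  forall s, a <= s < t ->
  [/\ \forall e \near (0 : R)^', Ck_at m (rem_th tau q e) s,
      \forall e \near (0 : R)^', Ck_at m (rem_q xi q e) s,
      forall k, (k <= m)%N ->
        is_o_eps setT (fun e : R => derive1n k (rem_th tau q e) s)
    & forall k, (k <= m)%N ->
        is_o_eps setT (fun e : R => derive1n k (rem_q xi q e) s)].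

(* The i-th derivative of qbar with respect to thetabar, as a function of
   theta. *)
Fixpoint dqb (q : R -> 'cV[R]_n) (e : R) (i : nat) : R -> 'cV[R]_n :=
  match i with
  | 0 => qbq q e
  | j.+1 => fun s => (derive1 (thbq q e) s)^-1 *: derive1 (dqb q e j) s
  end.

Definition jet_bar (m : nat) (q : R -> 'cV[R]_n) (e s : R) : 'M[R]_(n, m.+1) :=
  \matrix_(r < n, j < m.+1) dqb q e j s r ord0.

(* L is defined over [a, b] only and the weight on theta < t, so eps ranges
   over the small values for which a <= thetabar < t; for a < theta < t these
   are all the small eps. *)
Definition gauge_invariant (m : nat) (L : R * 'M[R]_(n, m.+1) -> R)
    (Lam : R * 'M[R]_(n, m.*2) -> R) (a b t alpha : R) : Prop :=
  forall q : R -> 'cV[R]_n, curve_C m.*2 a b q ->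
  forall s, a <= s < t ->
  is_o_eps [set e | a <= thbq q e s < t] (fun e : R =>
     L (thbq q e s, jet_bar m q e s) * (t - thbq q e s) `^ (alpha - 1)
       * derive1 (thbq q e) s
     - (Lq L q s * (t - s) `^ (alpha - 1)
        + e * (t - s) `^ (alpha - 1)
          * derive1 (fun u => Lam (u, jet m.*2 q u)) s)).

End Transformations.

(* Main.v *)
Require Import Defs.
From mathcomp Require Import all_boot all_order all_algebra.
From mathcomp Require Import all_classical all_reals all_analysis.
From mathcomp Require Import measurable_realfun.
From mathcomp Require Import ring.
Import Order.TTheory GRing.Theory Num.Theory.
Import numFieldNormedType.Exports.
Local Open Scope ring_scope.
Local Open Scope classical_set_scope.

(** Two computations of the same expression meet.

    Invariance, to first order. Along a fixed curve, the j-th derivative of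
    qbar with respect to thetabar is q^(j) + eps rho^j + o(eps): the recursion
    that divides by d thetabar / d theta = 1 + eps tau' + o(eps) becomes, in the
    coefficient of eps, the recursion defining rho ([kexpands_dqb]). Comparing
    the coefficients of eps on the two sides of the invariance identity and
    dividing by (t - theta)^(alpha - 1) gives [infinitesimal_invariance]:
      D_theta L tau + sum_j grad_j L . rho^j + L tau'
        + (1 - alpha) / (t - theta) L tau = d Lambda / d theta,
    where the last summand on the left comes from the weight.

    The derivative of the current. Since psi^j' = grad_(j-1) L - psi^(j-1), with
    psi^0 the left-hand side E of the Euler-Lagrange equation, the sums over j
    telescope, and along every curve ([is_derive_noetherC])
      C' = D_theta L tau + sum_j grad_j L . rho^j + L tau'
           - d Lambda / d theta - E . Omega.
    On a solution E = F, and Gamma (2 - alpha) = (1 - alpha) Gamma (1 - alpha)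
    turns F into (1 - alpha) / (t - theta) G ([EL_F_cond_G]). The condition
    G . Omega = - L tau therefore makes - E . Omega equal to the weight term of
    the first identity, and C' = 0.

    This argument needs thetabar to stay in [a, t) for all small eps, so it
    applies for a < theta < t. At theta = a the admissible eps may be one-sided
    or absent; there the mean value theorem concludes, because C is derivable
    at a and constant on ]a, t[ ([is_derive_left_endpoint]).

    Two notions carry the regularity: [kderivable], iterated derivability of a
    function of theta, and [kexpands], first-order expansion in eps of a family
    of functions of theta together with its first k theta-derivatives. *)

Set Implicit Arguments.
Unset Strict Implicit.

(** * The functional equation of Gamma *)

Section Gamma.
Context {R : realType}.
(** The windows exhaust ]0, +oo[; on each of them the integrand is continuous,
    although it may be singular at 0. *)
Let window (n : nat) : set R := `[n.+1%:R^-1, n.+2%:R].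

Lemma window_lt n : (n.+1%:R^-1 : R) < n.+2%:R.
Proof.
by rewrite (@le_lt_trans _ _ 1) ?ltr1n// invf_le1 ?ltr0n// ler1n.
Qed.

Lemma window_gt0 n u : window n u -> 0 < u.
Proof. by rewrite /window/= in_itv/= => /andP[nu _]; rewrite (lt_le_trans _ nu). Qed.

Lemma bigcup_window : \bigcup_n window n = `]0%R, +oo[%classic :> set R.
Proof.
apply/seteqP; split => [u [n _]|u].
  by move=> /window_gt0; rewrite /= in_itv/= andbT.
rewrite /= in_itv/= andbT => u0.
have [k uk] : exists k : nat, u < k%:R.
  by exists (Num.truncn u).+1; exact: truncnS_gt.
have [l ul] : exists k : nat, u^-1 < k%:R.
  by exists (Num.truncn u^-1).+1; exact: truncnS_gt.
exists (k + l)%N => //; rewrite /window /= in_itv/=; apply/andP; split.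
  rewrite -[leRHS]invrK lef_pV2 ?posrE ?invr_gt0 ?ltr0n//.
  by rewrite (le_trans (ltW ul))// ler_nat leqW// leq_addl.
by rewrite (le_trans (ltW uk))// ler_nat !leqW// leq_addr.
Qed.

Lemma nd_window : nondecreasing_seq window.
Proof.
apply/nondecreasing_seqP => n; apply/subsetPset => u.
rewrite /window /= !in_itv/= => /andP[nu un]; apply/andP; split.
  by apply: le_trans nu; rewrite lef_pV2 ?posrE ?ltr0n// ler_nat.
by apply: le_trans un _; rewrite ler_nat.
Qed.

Let integrand (x u : R) : R := u `^ x * expR (- u).

Lemma integrand_ge0 x u : 0 <= integrand x u.
Proof. by rewrite mulr_ge0// ?powR_ge0// expR_ge0. Qed.

Lemma derivable_powR_gt0 (x u : R) : 0 < u -> derivable (@powR R ^~ x) u 1.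
Proof. by move=> u0; apply: derivable_powR; rewrite in_itv/= andbT. Qed.

Lemma continuous_powR_gt0 (x u : R) : 0 < u -> {for u, continuous (@powR R ^~ x)}.
Proof.
move=> u0; apply/differentiable_continuous/derivable1_diffP.
exact: derivable_powR_gt0.
Qed.

Lemma continuous_expRN (u : R) : {for u, continuous (fun u : R => expR (- u))}.
Proof. by apply: continuous_comp; [exact: opp_continuous|exact: continuous_expR]. Qed.

Lemma continuous_integrand (x u : R) : 0 < u -> {for u, continuous (integrand x)}.
Proof.
by move=> u0; apply: continuousM; [exact: continuous_powR_gt0|exact: continuous_expRN].
Qed.

Lemma measurable_integrand (x : R) : measurable_fun (`]0%R, +oo[ : set R) (integrand x).
Proof.
apply: open_continuous_measurable_fun; first exact: interval_open.
by move=> u; rewrite inE/= in_itv/= andbT; exact: continuous_integrand.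
Qed.

Lemma integrand_cvg x : (\int[@lebesgue_measure R]_(u in window i) (integrand x u)%:E)%E
   @[i --> \oo] --> (\int[@lebesgue_measure R]_(u in `]0%R, +oo[) (integrand x u)%:E)%E.
Proof.
rewrite -bigcup_window; apply: ge0_nondecreasing_set_cvg_integral => //.
- exact: nd_window.
- by move=> i; exact: measurable_itv.
- move=> i; apply/measurable_EFinP; apply: measurable_funS (measurable_integrand x) => //.
  by rewrite -bigcup_window; exact: bigcup_sup.
- by move=> i u _; rewrite lee_fin integrand_ge0.
Qed.

(** Integration by parts of u^x against e^(-u), on a window so that the
    singularity at 0 and the infinite range are avoided. *)
Lemma integrand_parts (x : R) n : 0 < x ->
  (\int[@lebesgue_measure R]_(u in window n) (integrand x u)%:E =
   (integrand x n.+1%:R^-1 - integrand x n.+2%:R)%:E +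
   x%:E * \int[@lebesgue_measure R]_(u in window n) (integrand (x - 1) u)%:E)%E.
Proof.
move=> x0; have cin (f : R -> R) : (forall u, 0 < u -> {for u, continuous f}) ->
    {within `[n.+1%:R^-1, n.+2%:R], continuous f}.
  move=> cf; apply: continuous_in_subspaceT => u; rewrite inE => /window_gt0.
  exact: cf.
have LR (f : R -> R) : (forall u, 0 < u -> derivable f u 1) ->
    derivable_oo_LRcontinuous f n.+1%:R^-1 n.+2%:R.
  move=> df; have cf u : 0 < u -> {for u, continuous f}.
    by move=> /df /derivable1_diffP /differentiable_continuous.
  split.
  - by move=> u /subset_itv_oo_cc/window_gt0/df.
  - by apply: cvg_at_right_filter; apply: cf; rewrite invr_gt0.
  - by apply: cvg_at_left_filter; apply: cf.
have dG (u : R) : is_derive u (1 : R) (fun u : R => - expR (- u)) (expR (- u)).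
  by apply: is_derive_eq; rewrite /= mulrN1 opprK.
rewrite (@integration_by_parts _ (@powR R ^~ x) (fun u => - expR (- u))
  (fun u => x * u `^ (x - 1)) (fun u => expR (- u)) n.+1%:R^-1 n.+2%:R).
- congr (_ + _)%E; first by congr (_%:E); rewrite /integrand; ring.
  under eq_integral do rewrite mulrN EFinN -mulrA EFinM.
  rewrite integral_ge0N ?oppeK.
    rewrite ge0_integralZl_EFin//.
    - by move=> u _; rewrite lee_fin mulr_ge0// ?powR_ge0// expR_ge0.
    - apply/measurable_EFinP; apply: measurable_funS (measurable_integrand (x - 1)) => //.
      by rewrite -bigcup_window; exact: (@bigcup_sup _ _ n).
    - exact: ltW.
  by move=> u _; apply: mule_ge0; rewrite lee_fin; [exact: ltW|exact: integrand_ge0].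
- exact: window_lt.
- apply: cin => u u0; apply: continuousM; first exact: cst_continuous.
  exact: continuous_powR_gt0.
- apply: LR => u u0; exact: derivable_powR_gt0.
- move=> u /subset_itv_oo_cc/window_gt0 u0; rewrite powR_derive1//.
  by rewrite in_itv/= andbT.
- by apply: cin => u _; exact: continuous_expRN.
- by apply: LR => u _; exact: ex_derive.
- by move=> u _; rewrite derive1E; exact: derive_val.
Qed.

Lemma integrand_cvg_at0 (x : R) : 0 < x ->
  integrand x n.+1%:R^-1 @[n --> \oo] --> (0 : R).
Proof.
move=> x0; have : (n.+1%:R^-1 : R) `^ x @[n --> \oo] --> (0 : R).
  have := powR_cvg0 x0; move=> /cvg_at_rightP; apply.
  by split => [n|]; [rewrite invr_gt0|exact: cvg_harmonic].
apply: squeeze_cvgr (cvg_cst 0); near=> n.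
by rewrite integrand_ge0 /integrand ler_piMr ?powR_ge0// expR_le1 oppr_le0.
Unshelve. all: by end_near. Qed.

(** For a natural k > x, u^x e^(-u) <= u^k (k+1)! / u^(k+1) = (k+1)! / u, from
    the Taylor lower bound of e^u. *)
Lemma integrand_cvg_aty (x : R) : 0 < x ->
  integrand x n.+2%:R @[n --> \oo] --> (0 : R).
Proof.
move=> x0; pose k := (Num.truncn x).+1.
have : (k.+1`!%:R * n.+1%:R^-1 : R) @[n --> \oo] --> (0 : R).
  by rewrite -(mulr0 k.+1`!%:R); apply: cvgMr; exact: cvg_harmonic.
apply: squeeze_cvgr (cvg_cst 0); near=> n.
rewrite integrand_ge0 /=.
have n0 : 0 < n.+2%:R :> R by [].
apply: (@le_trans _ _ (n.+2%:R ^+ k * (n.+2%:R ^+ k.+1 / k.+1`!%:R)^-1)).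
  apply: ler_pM; rewrite ?powR_ge0 ?expR_ge0//.
    by rewrite -powR_mulrn// ler_powR ?ler1n// ltW// truncnS_gt.
  rewrite expRN lef_pV2 ?posrE ?expR_gt0 ?divr_gt0 ?exprn_gt0 ?ltr0n ?fact_gt0//.
  by apply: le_trans (expR_ge1Dxn k (ltW n0)); rewrite lerDr.
rewrite invf_div mulrCA exprS invfM [X in _ * X]mulrCA divff ?mulr1 ?expf_neq0 ?gt_eqF//.
by rewrite ler_wpM2l// lef_pV2 ?posrE// ler_nat.
Unshelve. all: by end_near. Qed.

(** The windowed identities pass to the limit by monotone convergence, the
    boundary terms vanishing. The integrals are compared in the extended reals;
    passing to real values commutes with the factor x, as fine sends the infinities to 0. *)
Lemma GammaS (x : R) : 0 < x -> Gamma (x + 1) = x * Gamma x.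
Proof.
move=> x0; rewrite /Gamma /Rintegral.
rewrite addrK.
suff -> : (\int[@lebesgue_measure R]_(u in `]0%R, +oo[) (integrand x u)%:E =
  x%:E * \int[@lebesgue_measure R]_(u in `]0%R, +oo[) (integrand (x - 1) u)%:E)%E.
  case: (integral _ _ _) => [r||]; rewrite ?EFinM//.
    by rewrite gt0_muley ?lte_fin//= mulr0.
  by rewrite gt0_muleNy ?lte_fin//= mulr0.
rewrite -(cvg_lim _ (@integrand_cvg x))//; apply: cvg_lim => //.
rewrite (funext (fun n => integrand_parts n x0)) -[(x%:E * _)%E]add0e.
apply: cvgeD => //.
  apply: cvg_EFin; first exact: nearW.
  by rewrite -(subr0 0); apply: cvgB; [exact: integrand_cvg_at0|exact: integrand_cvg_aty].
by apply: cvgeZl => //; exact: integrand_cvg.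
Qed.
End Gamma.

(** * Iterated derivability near a point *)

Section Kderivable.
Context {R : realType}.

(** The inductive wrapper keeps automation from unfolding the quantifiers. *)
Variant kderivable (V : normedModType R) k (f : R -> V) (s : R) : Prop :=
  Kderivable of forall j, (j < k)%N -> \forall u \near s, derivable (f^`(j)) u 1.

Section Generic.
Context {V : normedModType R}.
Implicit Types f g : R -> V.
Implicit Types s : R.

Lemma kderivableS k f s : kderivable k.+1 f s <->
  (\forall u \near s, derivable f u 1) /\ kderivable k f^`() s.
Proof.
split=> [[H]|[H0 [H]]].
  split; first exact: (H 0%N).
  by split=> j jk; rewrite -derive1Sn; exact: H.
split=> -[_|j jk]; first exact: H0.
by rewrite derive1Sn; exact: H.
Qed.

Lemma kderivable_le j k f s : (j <= k)%N -> kderivable k f s -> kderivable j f s.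
Proof. by move=> jk [H]; split=> i ij; apply: H; exact: leq_trans jk. Qed.

Lemma kderivable_derive1n i k f s : kderivable (i + k) f s -> kderivable k f^`(i) s.
Proof.
move=> [H]; split=> j jk; have := H (j + i)%N; rewrite /derive1n iterD; apply.
by rewrite addnC ltn_add2l.
Qed.

Lemma kderivable_near k f s : kderivable k.+1 f s -> \forall u \near s, derivable f u 1.
Proof. by case=> /(_ 0%N isT). Qed.

Lemma kderivable_derivable k f s : kderivable k.+1 f s -> derivable f s 1.
Proof. by move=> /kderivable_near/nbhs_singleton. Qed.

Lemma is_derive_derive1n k f s :
  kderivable k.+1 f s -> is_derive s (1 : R) f^`(k) (f^`(k.+1) s).
Proof.
move=> [/(_ k (ltnSn k))/nbhs_singleton fk].
by apply: DeriveDef; [exact: fk|rewrite -derive1E].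
Qed.

Lemma derivable_continuous f s : derivable f s 1 -> {for s, continuous f}.
Proof. by move=> /derivable1_diffP/differentiable_continuous. Qed.

Lemma near_eq_derive1 f g s :
  (\forall u \near s, f u = g u) -> (\forall u \near s, f^`() u = g^`() u).
Proof.
move=> /nbhs_interior fg; near=> u.
by rewrite !derive1E; apply: near_eq_derive; exact: (near fg u).
Unshelve. all: by end_near. Qed.

Lemma near_eq_derive1n k f g s :
  (\forall u \near s, f u = g u) -> (\forall u \near s, f^`(k) u = g^`(k) u).
Proof. by move=> fg; elim: k => // k; exact: near_eq_derive1. Qed.

Lemma near_eq_kderivable k f g s :
  (\forall u \near s, f u = g u) -> kderivable k f s -> kderivable k g s.
Proof.
move=> fg [H]; split=> j jk; have /nbhs_interior fgj := near_eq_derive1n j fg.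
have Hj := H j jk; near=> u; apply: (near_eq_derivable (f := f^`(j))).
  exact: (near fgj u).
exact: (near Hj u).
Unshelve. all: by end_near. Qed.

Lemma Ck_at_kderivable k f s : Ck_at k f s -> kderivable k f s.
Proof.
elim: k f => [f _|k IH f /= [fs Dfs]]; first by split.
apply/kderivableS; split.
  by near=> u; apply: diff_derivable; near: u.
rewrite (_ : f^`() = 'D_1 f); first exact: IH.
by apply/funext => u; rewrite derive1E.
Unshelve. all: by end_near. Qed.

Lemma derive1n_cst k (c : V) s : (cst c)^`(k.+1) s = 0.
Proof.
elim: k s => [|k IH] s; first by rewrite derive1n1 derive1_cst.
by rewrite derive1nS (funext IH) derive1_cst.
Qed.

Lemma kderivable_cst k (c : V) s : kderivable k (cst c) s.
Proof.
split=> -[|j] _; near=> u; first exact: derivable_cst.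
by rewrite (funext (derive1n_cst j c)); exact: derivable_cst.
Unshelve. all: by end_near. Qed.

Lemma near_derive1D k f g s : kderivable k.+1 f s -> kderivable k.+1 g s ->
  \forall u \near s, (f \+ g)^`() u = derive1 f u + derive1 g u.
Proof.
move=> /kderivable_near Hf /kderivable_near Hg; apply: filterS2 Hf Hg => u fu gu.
by rewrite !derive1E (deriveD fu gu).
Qed.

Lemma kderivableD k f g s :
  kderivable k f s -> kderivable k g s -> kderivable k (f \+ g) s.
Proof.
elim: k f g => [|k IH] f g Hf Hg; first by split.
apply/kderivableS; split.
  by apply: filterS2 (kderivable_near Hf) (kderivable_near Hg) => u; exact: derivableD.
apply: (@near_eq_kderivable _ (derive1 f \+ derive1 g)).
  by apply: filterS (near_derive1D Hf Hg) => u ->.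
by apply: IH; [case/kderivableS: Hf|case/kderivableS: Hg].
Qed.

End Generic.

Section Scalar.
Implicit Types f g : R -> R.
Implicit Types s : R.

Lemma kderivable_id k s : kderivable k (@id R) s.
Proof.
case: k => [|k]; first by split.
apply/kderivableS; split; first by apply: filterE => u; exact: derivable_id.
rewrite (_ : derive1 (@id R) = @cst R R 1); first exact: kderivable_cst.
by apply/funext => u; rewrite derive1E derive_id.
Qed.

Lemma near_derive1M k f g s : kderivable k.+1 f s -> kderivable k.+1 g s ->
  \forall u \near s, (f \* g)^`() u = derive1 f u * g u + f u * derive1 g u.
Proof.
move=> /kderivable_near Hf /kderivable_near Hg; apply: filterS2 Hf Hg => u fu gu.
by rewrite !derive1E (deriveM fu gu) /GRing.scale/= addrC [g u * _]mulrC.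
Qed.

Lemma kderivableM k f g s :
  kderivable k f s -> kderivable k g s -> kderivable k (f \* g) s.
Proof.
elim: k f g => [|k IH] f g Hf Hg; first by split.
apply/kderivableS; split.
  by apply: filterS2 (kderivable_near Hf) (kderivable_near Hg) => u; exact: derivableM.
apply: (@near_eq_kderivable _ _ ((derive1 f \* g) \+ (f \* derive1 g))).
  by apply: filterS (near_derive1M Hf Hg) => u ->.
apply: kderivableD; apply: IH; try exact: (kderivable_le (leqnSn k)).
  by case/kderivableS: Hf.
by case/kderivableS: Hg.
Qed.

Lemma kderivable_sum (I : Type) (r : seq I) k (F : I -> R -> R) s :
  (forall i, kderivable k (F i) s) -> kderivable k (fun u => \sum_(i <- r) F i u) s.
Proof.
move=> H; elim: r => [|i r IH].
  rewrite (_ : (fun _ => _) = cst 0); first exact: kderivable_cst.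
  by apply/funext => u; rewrite big_nil.
rewrite (_ : (fun _ => _) = F i \+ (fun u => \sum_(i <- r) F i u)).
  exact: kderivableD.
by apply/funext => u /=; rewrite big_cons.
Qed.

End Scalar.

Section Matrix.
Context {p r : nat}.
Implicit Types M : R -> 'M[R]_(p, r).
Implicit Types s : R.

Lemma near_derive1_mx M s : (\forall u \near s, derivable M u 1) ->
  forall i j, \forall u \near s, M^`() u i j = (fun u => M u i j)^`() u.
Proof.
move=> HM i j; near=> u.
by rewrite !derive1E derive_mx ?mxE//; near: u.
Unshelve. all: by end_near. Qed.

(** Reduces products of a scalar and a vector function to products of scalars. *)
Lemma kderivable_mxP k M s :
  kderivable k M s <-> forall i j, kderivable k (fun u => M u i j) s.
Proof.
elim: k M => [|k IH] M; first by split=> _ => [i j|]; split.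
split.
  move=> /kderivableS[M1 /IH H] i j; apply/kderivableS; split.
    by apply: filterS M1 => u /derivable_mxP.
  by apply: near_eq_kderivable (H i j); exact: near_derive1_mx.
move=> H; have HM : \forall u \near s, derivable M u 1.
  have HM : \forall u \near s, forall ij : 'I_p * 'I_r,
      derivable (fun u => M u ij.1 ij.2) u 1.
    exact: (@filter_forall _ _ (fun ij => [set u | derivable
      (fun u => M u ij.1 ij.2) u 1]) _ _ (fun ij => kderivable_near (H ij.1 ij.2))).
  by apply: filterS HM => u Mu; apply/derivable_mxP => i j; exact: (Mu (i, j)).
apply/kderivableS; split; first exact: HM.
apply/IH => i j.
apply: (@near_eq_kderivable _ _ (fun u => M u i j)^`()).
  by apply: filterS (near_derive1_mx HM i j) => u ->.
by have /kderivableS[] := H i j.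
Qed.

Lemma near_derive1n_mx k M s : kderivable k M s ->
  forall i j, \forall u \near s, M^`(k) u i j = (fun u => M u i j)^`(k) u.
Proof.
elim: k M => [M _ i j|k IH M HM i j]; first by apply: filterE.
have /kderivableS[M1 /IH Hk] := HM.
rewrite !derive1Sn; apply: filterS2 (Hk i j) _; last first.
  exact/near_eq_derive1n/(near_derive1_mx M1 i j).
by move=> u /= -> ->.
Qed.

End Matrix.
End Kderivable.

(** * The chain rule along a curve with matrix values *)

Section Chain.
Context {R : realType}.

Definition partial_entry {p r} (F : R * 'M[R]_(p, r) -> R) (i : 'I_p) (j : 'I_r) x : R :=
  'D_((0, delta_mx i j) : R * 'M[R]_(p, r)) F x.

Definition partial_theta {p r} (F : R * 'M[R]_(p, r) -> R) x : R :=
  'D_((1, 0) : R * 'M[R]_(p, r)) F x.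

(** A differential on R x M_(p,r) is determined by its values on the basis
    (1, 0), (0, delta_ij). *)
Lemma diff_pair_mx p r (F : R * 'M[R]_(p, r) -> R) x c (A : 'M[R]_(p, r)) :
  differentiable F x ->
  'd F x (c, A) = c * partial_theta F x +
    \sum_(i < p) \sum_(j < r) A i j * partial_entry F i j x.
Proof.
move=> dF; rewrite /partial_theta /partial_entry deriveE//.
under eq_bigr do under eq_bigr do rewrite deriveE//.
have -> : (c, A) = c *: ((1 : R), (0 : 'M[R]_(p, r))) +
    \sum_(i < p) \sum_(j < r) A i j *: ((0 : R), delta_mx i j).
  rewrite [RHS]surjective_pairing; congr pair.
  - change (c = c * 1 + (\sum_(i < p) \sum_(j < r)
      A i j *: ((0 : R), (delta_mx i j : 'M[R]_(p, r)))).1).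
    rewrite (big_morph fst (fun _ _ => erefl) erefl) mulr1 big1 ?addr0// => i _.
    by rewrite (big_morph fst (fun _ _ => erefl) erefl) big1// => j _; exact: mulr0.
  - change (A = c *: 0 + (\sum_(i < p) \sum_(j < r)
      A i j *: ((0 : R), (delta_mx i j : 'M[R]_(p, r)))).2).
    rewrite (big_morph snd (fun _ _ => erefl) erefl) scaler0 add0r.
    rewrite [LHS]matrix_sum_delta; apply: eq_bigr => i _.
    by rewrite (big_morph snd (fun _ _ => erefl) erefl).
rewrite linearD linearZ linear_sum; congr (_ + _).
apply: eq_bigr => i _; rewrite linear_sum; apply: eq_bigr => j _.
by rewrite linearZ.
Qed.

Lemma is_derive_pair_mx p r (F : R * 'M[R]_(p, r) -> R)
    (g : R -> R) (M : R -> 'M[R]_(p, r)) (x : R) (dg : R) (dM : 'I_p -> 'I_r -> R) :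
  is_derive x (1 : R) g dg ->
  (forall i j, is_derive x (1 : R) (fun u => M u i j) (dM i j)) ->
  differentiable F (g x, M x) ->
  is_derive x (1 : R) (fun u => F (g u, M u))
    (dg * partial_theta F (g x, M x) +
     \sum_(i < p) \sum_(j < r) dM i j * partial_entry F i j (g x, M x)).
Proof.
move=> [dg1 <-] dM1 dF.
have dM2 : derivable M x 1 by apply/derivable_mxP => i j; have [] := dM1 i j.
have dgM : differentiable (fun u => (g u, M u)) x.
  by apply: differentiable_pair; exact/derivable1_diffP.
have dFgM : differentiable (F \o (fun u => (g u, M u))) x.
  exact: differentiable_comp.
apply: DeriveDef; first exact/derivable1_diffP.
rewrite deriveE// diff_comp//= diff_pair//=; try exact/derivable1_diffP.
rewrite diff_pair_mx// -!deriveE; try exact/derivable1_diffP.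
congr (_ + _); apply: eq_bigr => i _; apply: eq_bigr => j _.
by rewrite derive_mx// mxE; have [_ ->] := dM1 i j.
Qed.

(** The map l is the identity or a matrix entry; treating both at once avoids
    having to know that Ck_at is inherited by the entries of a function. *)
Section Composition.
Context {p r : nat} (W : normedModType R) (l : W -> R).
Hypothesis diff_l : forall (G : R * 'M[R]_(p, r) -> W) x v,
  differentiable G x -> differentiable (l \o G) x /\ 'D_v (l \o G) x = l ('D_v G x).

(** By the chain rule the derivative of G along the curve is a sum of products
    of derivatives of the curve and of partial derivatives of G along the same
    curve; the latter fall under the induction hypothesis. *)
Lemma kderivable_comp_linear k (G : R * 'M[R]_(p, r) -> W) (M : R -> 'M[R]_(p, r)) s :
  Ck_at k G (s, M s) -> kderivable k M s -> kderivable k (fun u => l (G (u, M u))) s.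
Proof.
elim: k G => [G _ _|k IH G /= [dG DG] sM]; first by split.
have cM : {for s, continuous (fun u => (u, M u))}.
  apply/differentiable_continuous/differentiable_pair; first exact: ex_diff.
  exact/derivable1_diffP/(kderivable_derivable sM).
have dGu : \forall u \near s, differentiable G (u, M u).
  exact: (cM [set y | differentiable G y] dG).
have dMu := kderivable_near sM.
have der : \forall u \near s, is_derive u (1 : R) (fun u => l (G (u, M u)))
    (l ('D_(1, 0) G (u, M u)) + \sum_(i < p) \sum_(j < r)
      derive1 (fun u => M u i j) u * l ('D_(0, delta_mx i j) G (u, M u))).
  apply: filterS2 dGu dMu => u dG1 /derivable_mxP dM1.
  have [dlG DlG] := diff_l (1, 0) dG1.
  have dMu1 i j : is_derive u (1 : R) (fun u => M u i j) (derive1 (fun u => M u i j) u).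
    by apply: DeriveDef; [exact: dM1|rewrite derive1E].
  apply: is_derive_eq
    (@is_derive_pair_mx _ _ (l \o G) id M u 1 _ (is_derive_id _ _) dMu1 dlG) _.
  rewrite mul1r; congr (_ + _); first exact: DlG.
  apply: eq_bigr => i _; apply: eq_bigr => j _; congr (_ * _).
  exact: (diff_l (0, delta_mx i j) dG1).2.
apply/kderivableS; split; first by apply: filterS der => u [].
apply: (@near_eq_kderivable _ _ _ (fun u => l ('D_(1, 0) G (u, M u)) +
    \sum_(i < p) \sum_(j < r)
      derive1 (fun u => M u i j) u * l ('D_(0, delta_mx i j) G (u, M u)))).
  by apply: filterS der => u [_ <-]; rewrite derive1E.
have sMk := kderivable_le (leqnSn k) sM.
apply: kderivableD; first exact: (IH _ (DG _)).
apply: kderivable_sum => i; apply: kderivable_sum => j.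
apply: kderivableM; last exact: (IH _ (DG _)).
by have /kderivable_mxP/(_ i j)/kderivableS[] := sM.
Qed.

End Composition.

Lemma kderivable_comp p r k (F : R * 'M[R]_(p, r) -> R) (M : R -> 'M[R]_(p, r)) s :
  Ck_at k F (s, M s) -> kderivable k M s -> kderivable k (fun u => F (u, M u)) s.
Proof. by apply: (@kderivable_comp_linear _ _ _ id) => G x v dG; split. Qed.

Lemma kderivable_comp_mx p r a b k (F : R * 'M[R]_(p, r) -> 'M[R]_(a, b))
    (M : R -> 'M[R]_(p, r)) s :
  Ck_at k F (s, M s) -> kderivable k M s -> kderivable k (fun u => F (u, M u)) s.
Proof.
move=> CF sM; apply/kderivable_mxP => i j; move: CF sM.
apply: (@kderivable_comp_linear _ _ _ (fun A : 'M[R]_(a, b) => A i j)) => G x v dG.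
split; last by rewrite (derive_mx (diff_derivable dG)) mxE.
exact/(differentiable_comp dG)/differentiable_coord.
Qed.

Lemma Ck_atW (V W : normedModType R) k (f : V -> W) x : Ck_at k.+1 f x -> Ck_at k f x.
Proof.
elim: k f => [f [df _]|k IH f [df Df]].
  by apply: filterS df => y; exact: differentiable_continuous.
by split=> // v; exact: IH.
Qed.

Lemma Ck_at_le (V W : normedModType R) j k (f : V -> W) x :
  (j <= k)%N -> Ck_at k f x -> Ck_at j f x.
Proof.
elim: k => [|k IH]; first by rewrite leqn0 => /eqP->.
by rewrite leq_eqVlt => /orP[/eqP->//|/IH H /Ck_atW]; exact: H.
Qed.

End Chain.

(** * First-order expansions in eps *)

Section Expansion.
Context {R : realType}.
Implicit Types f g : R -> R.

(** An expansion f(e) = c0 + e c1 + o(e) for e <> 0 says exactly that f, given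
    the value c0 at 0, has derivative c1 there. In this form sums, products and
    compositions of expansions are the rules of differential calculus, whatever
    the value f 0. *)
Definition patch0 (c0 : R) f (e : R) : R := if e == 0 then c0 else f e.

Definition expands f (c0 c1 : R) := is_derive (0 : R) (1 : R) (patch0 c0 f) c1.

Lemma patch0_0 c0 f : patch0 c0 f 0 = c0.
Proof. by rewrite /patch0 eqxx. Qed.

(** If the condition D holds for all small e, restricting to it loses nothing. *)
Lemma is_o_expands (D : set R) f : is_o_eps D f -> (\forall e \near (0 : R)^', D e) ->
  expands f 0 0.
Proof.
rewrite /is_o_eps => /eqoP fo Dnear.
have H : (fun h : R => h^-1 *: ((patch0 0 f \o shift 0) (h *: 1) - patch0 0 f 0))
    @ 0^' --> (0 : R).
  apply/cvgr0Pnorm_le => eps eps0.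
  have fe := fo eps eps0.
  near=> h.
  have h0 : h != 0 by near: h; exact: nbhs_dnbhs_neq.
  rewrite patch0_0 subr0 /= addr0 /patch0 /GRing.scale/= mulr1 (negbTE h0).
  rewrite normrM normfV ler_pdivrMl ?normr_gt0// mulrC.
  have Dh : D h by near: h.
  move: Dh; near: h; exact: fe.
by split; [apply/cvg_ex; exists 0|exact: cvg_lim H].
Unshelve. all: by end_near. Qed.

Lemma expands_unique f c0 c1 d1 : expands f c0 c1 -> expands f c0 d1 -> c1 = d1.
Proof. by move=> [_ <-] [_ <-]. Qed.

Lemma near_eq_expands f g c0 c1 : (\forall e \near (0 : R)^', f e = g e) ->
  expands f c0 c1 -> expands g c0 c1.
Proof.
move=> fg; apply: near_eq_is_derive.
have fg' : \forall e \near (0 : R), e != 0 -> f e = g e by exact: fg.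
apply: filterS fg' => e fge; rewrite /patch0.
by case: (eqVneq e 0) => // e0; exact: fge.
Qed.

Lemma expands_is_derive (h : R -> R) c1 :
  is_derive (0 : R) (1 : R) h c1 -> expands h (h 0) c1.
Proof.
apply: near_eq_is_derive; apply: filterE => e.
by rewrite /patch0; case: eqP => [->|].
Qed.

Lemma expands_cst (c : R) : expands (cst c) c 0.
Proof. by apply: (@expands_is_derive (cst c)); exact: is_derive_cst. Qed.

Lemma expands_id : expands id 0 1.
Proof. by apply: (@expands_is_derive id); exact: is_derive_id. Qed.

Lemma expandsD f g c0 c1 d0 d1 : expands f c0 c1 -> expands g d0 d1 ->
  expands (f \+ g) (c0 + d0) (c1 + d1).
Proof.
move=> Hf Hg.
apply: (@near_eq_is_derive _ _ _ (patch0 c0 f + patch0 d0 g)).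
  apply: filterE => e; rewrite /patch0.
  by rewrite -[LHS]/(_ + _); case: ifP.
exact: is_deriveD.
Qed.

Lemma expandsM f g c0 c1 d0 d1 : expands f c0 c1 -> expands g d0 d1 ->
  expands (f \* g) (c0 * d0) (c0 * d1 + c1 * d0).
Proof.
move=> Hf Hg.
apply: (@near_eq_is_derive _ _ _ (patch0 c0 f * patch0 d0 g)).
  apply: filterE => e; rewrite /patch0.
  by rewrite -[LHS]/(_ * _); case: ifP.
apply: is_derive_eq (is_deriveM Hf Hg) _.
by rewrite !patch0_0 /GRing.scale/= [d0 * _]mulrC.
Qed.

Lemma expands_comp (h : R -> R) f c0 c1 dh :
  is_derive c0 (1 : R) h dh -> expands f c0 c1 ->
  expands (h \o f) (h c0) (c1 * dh).
Proof.
move=> h1 f1.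
apply: (@near_eq_is_derive _ _ _ (h \o patch0 c0 f)).
  by apply: filterE => e; rewrite /patch0 /=; case: ifP.
move: f1 h1; rewrite /expands -{2}(patch0_0 c0 f).
by move: (patch0 c0 f) => k k1 h1; rewrite mulrC; exact: is_derive1_comp.
Qed.

Lemma expands_pair_mx p r (F : R * 'M[R]_(p, r) -> R)
    (g : R -> R) (M : R -> 'M[R]_(p, r)) c0 c1 (M0 M1 : 'M[R]_(p, r)) :
  expands g c0 c1 ->
  (forall i j, expands (fun e => M e i j) (M0 i j) (M1 i j)) ->
  differentiable F (c0, M0) ->
  expands (fun e => F (g e, M e)) (F (c0, M0))
    (c1 * partial_theta F (c0, M0) +
     \sum_(i < p) \sum_(j < r) M1 i j * partial_entry F i j (c0, M0)).
Proof.
move=> Hg HM dF.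
pose N e : 'M[R]_(p, r) := if e == 0 then M0 else M e.
have N0 : N 0 = M0 by rewrite /N eqxx.
apply: (@near_eq_is_derive _ _ _ (fun e => F (patch0 c0 g e, N e))).
  by apply: filterE => e; rewrite /patch0 /N; case: ifP.
rewrite -{2 3}(patch0_0 c0 g) -{1 2}N0.
have HN i j : is_derive (0 : R) (1 : R) (fun e => N e i j) (M1 i j).
  apply: near_eq_is_derive (HM i j).
  by apply: filterE => e; rewrite /patch0 /N; case: ifP.
have dFN : differentiable F (patch0 c0 g 0, N 0) by rewrite patch0_0 N0.
exact: (@is_derive_pair_mx _ _ _ F (patch0 c0 g) N 0 c1 (fun i j => M1 i j) Hg HN dFN).
Qed.

Lemma expands_cvg f c0 c1 : expands f c0 c1 -> f e @[e --> 0^'] --> c0.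
Proof.
move=> [/derivable_continuous cf _].
have : patch0 c0 f e @[e --> 0^'] --> c0.
  by rewrite -{2}(patch0_0 c0 f); apply: cvg_within_filter; exact: cf.
apply: cvg_trans; apply: near_eq_cvg.
near=> e; rewrite /patch0 ifN//; near: e; exact: nbhs_dnbhs_neq.
Unshelve. all: by end_near. Qed.

End Expansion.

(** * First-order expansions of families of functions *)

Section FamilyExpansion.
Context {R : realType}.
Implicit Types (f g : R -> R -> R) (s : R).

(** The expansion f_e = f0 + e f1 + o(e), with its first k theta-derivatives,
    is taken at the point s alone, since the neighbourhood of s on which f_e is
    derivable may depend on e. *)
Record kexpands k f (f0 f1 : R -> R) s : Prop := Kexpands {
  kexpands_kderivable : \forall e \near (0 : R)^', kderivable k (f e) s ;
  kexpands_kderivable0 : kderivable k f0 s ;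
  kexpands_kderivable1 : kderivable k f1 s ;
  kexpands_expands : forall j, (j <= k)%N ->
    expands (fun e => derive1n j (f e) s) (derive1n j f0 s) (derive1n j f1 s) }.

Lemma near_eq_kexpands k f g (f0 g0 f1 g1 : R -> R) s :
  (\forall e \near (0 : R)^', \forall u \near s, f e u = g e u) ->
  (\forall u \near s, f0 u = g0 u) -> (\forall u \near s, f1 u = g1 u) ->
  kexpands k f f0 f1 s -> kexpands k g g0 g1 s.
Proof.
move=> fg fg0 fg1 [sf sf0 sf1 ef]; split.
- by apply: filterS2 fg sf => e; exact: near_eq_kderivable.
- exact: near_eq_kderivable fg0 sf0.
- exact: near_eq_kderivable fg1 sf1.
- move=> j jk; have -> := esym (nbhs_singleton (near_eq_derive1n j fg0)).
  have -> := esym (nbhs_singleton (near_eq_derive1n j fg1)).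
  apply: near_eq_expands (ef j jk).
  by apply: filterS fg => e fge; exact: nbhs_singleton (near_eq_derive1n j fge).
Qed.

Lemma kexpands0 k f (f0 f1 : R -> R) s : kexpands k f f0 f1 s ->
  expands (fun e => f e s) (f0 s) (f1 s).
Proof. by move=> [_ _ _ /(_ 0%N isT)]. Qed.

(** The recursive form, on which the closure properties are proved by
    induction on k: apply the rule for e-expansions at s, and the induction
    hypothesis to the theta-derivative. *)
Lemma kexpandsS k f (f0 f1 : R -> R) s : kexpands k.+1 f f0 f1 s <->
  [/\ \forall e \near (0 : R)^', kderivable k.+1 (f e) s, kderivable k.+1 f0 s,
      kderivable k.+1 f1 s, expands (fun e => f e s) (f0 s) (f1 s) &
      kexpands k (fun e => derive1 (f e)) (derive1 f0) (derive1 f1) s].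
Proof.
split=> [[sf sf0 sf1 ef]|[sf sf0 sf1 ef0 [_ _ _ ef]]].
- split; [exact: sf|exact: sf0|exact: sf1|exact: (ef 0%N)|split].
  + by apply: filterS sf => e /kderivableS[].
  + by case/kderivableS: sf0.
  + by case/kderivableS: sf1.
  + move=> j jk; have := ef j.+1 jk; rewrite !derive1Sn.
    by under [X in expands X _ _]eq_fun do rewrite derive1Sn.
- split; [exact: sf|exact: sf0|exact: sf1|case=> [_|j jk]]; first exact: ef0.
  have := ef j jk; rewrite -!derive1Sn.
  by under [X in expands X _ _]eq_fun do rewrite -derive1Sn.
Qed.

Lemma kexpands_le j k f (f0 f1 : R -> R) s : (j <= k)%N ->
  kexpands k f f0 f1 s -> kexpands j f f0 f1 s.
Proof.
move=> jk [sf sf0 sf1 ef]; split; try exact: kderivable_le jk _.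
- by apply: filterS sf => e; exact: kderivable_le.
- by move=> i ij; apply: ef; exact: leq_trans jk.
Qed.

Lemma kexpandsD k f g (f0 g0 f1 g1 : R -> R) s :
  kexpands k f f0 f1 s -> kexpands k g g0 g1 s ->
  kexpands k (fun e => f e \+ g e) (f0 \+ g0) (f1 \+ g1) s.
Proof.
elim: k f g f0 g0 f1 g1 => [|k IH] f g f0 g0 f1 g1 Hf Hg.
  split; first by apply: filterE => e; split.
  - by split.
  - by split.
  - move=> j; rewrite leqn0 => /eqP->.
    exact: expandsD (kexpands0 Hf) (kexpands0 Hg).
move: (Hf) (Hg) => /kexpandsS[sf sf0 sf1 ef Hf'] /kexpandsS[sg sg0 sg1 eg Hg'].
apply/kexpandsS; split.
- by apply: filterS2 sf sg => e; exact: kderivableD.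
- exact: kderivableD.
- exact: kderivableD.
- exact: expandsD.
- apply: near_eq_kexpands (IH _ _ _ _ _ _ Hf' Hg').
  + apply: filterS2 sf sg => e sfe sge.
    by apply: filterS (near_derive1D sfe sge) => u ->.
  + by apply: filterS (near_derive1D sf0 sg0) => u ->.
  + by apply: filterS (near_derive1D sf1 sg1) => u ->.
Qed.

(** The coefficients multiply as dual numbers do: the theta-derivative is a
    derivation on families, so the induction closes. *)
Lemma kexpandsM k f g (f0 g0 f1 g1 : R -> R) s :
  kexpands k f f0 f1 s -> kexpands k g g0 g1 s ->
  kexpands k (fun e => f e \* g e) (f0 \* g0) ((f0 \* g1) \+ (f1 \* g0)) s.
Proof.
elim: k f g f0 g0 f1 g1 => [|k IH] f g f0 g0 f1 g1 Hf Hg.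
  split; first by apply: filterE => e; split.
  - by split.
  - by split.
  - move=> j; rewrite leqn0 => /eqP->.
    exact: expandsM (kexpands0 Hf) (kexpands0 Hg).
move: (Hf) (Hg) => /kexpandsS[sf sf0 sf1 ef Hf'] /kexpandsS[sg sg0 sg1 eg Hg'].
apply/kexpandsS; split.
- by apply: filterS2 sf sg => e; exact: kderivableM.
- exact: kderivableM.
- by apply: kderivableD; exact: kderivableM.
- exact: expandsM.
- have Hfk := kexpands_le (leqnSn k) Hf; have Hgk := kexpands_le (leqnSn k) Hg.
  apply: near_eq_kexpands
    (kexpandsD (IH _ _ _ _ _ _ Hf' Hgk) (IH _ _ _ _ _ _ Hfk Hg')).
  + apply: filterS2 sf sg => e sfe sge.
    by apply: filterS (near_derive1M sfe sge) => u ->.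
  + by apply: filterS (near_derive1M sf0 sg0) => u ->.
  + have h1 := near_derive1M sf0 sg1; have h2 := near_derive1M sf1 sg0.
    have h3 := near_derive1D (kderivableM sf0 sg1) (kderivableM sf1 sg0).
    apply: filterS3 h1 h2 h3 => u h1 h2 h3.
    by rewrite h3 h1 h2 /= addrACA [_ * _ + _ * derive1 g0 u]addrC addrACA; ring.
Qed.

Lemma kexpands_cst k (f0 : R -> R) s :
  kderivable k f0 s -> kexpands k (fun=> f0) f0 (cst 0) s.
Proof.
move=> sf0; split; [by apply: filterE|exact: sf0|exact: kderivable_cst|].
move=> j _; have -> : derive1n j (cst (0 : R)) s = 0.
  by case: j => // j; rewrite derive1n_cst.
exact: expands_cst.
Qed.

Lemma kexpands_o k f s :
  (\forall e \near (0 : R)^', kderivable k (f e) s) ->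
  (forall j, (j <= k)%N -> expands (fun e => derive1n j (f e) s) 0 0) ->
  kexpands k f (cst 0) (cst 0) s.
Proof.
move=> sf fo; split; [exact: sf|exact: kderivable_cst|exact: kderivable_cst|].
move=> j jk; have -> : derive1n j (cst (0 : R)) s = 0.
  by case: j {jk} => // j; rewrite derive1n_cst.
exact: fo.
Qed.

Lemma kexpands_eps k s : kexpands k (fun e => cst e) (cst 0) (cst 1) s.
Proof.
split; try exact: kderivable_cst; first by apply: filterE => e; exact: kderivable_cst.
case=> [|j] _; first exact: expands_id.
rewrite !derive1n_cst; under [X in expands X _ _]eq_fun do rewrite derive1n_cst.
exact: expands_cst.
Qed.

Lemma near_derive1V k (h : R -> R) s : kderivable k.+1 h s -> h s != 0 ->
  \forall u \near s, is_derive u (1 : R) (fun u => (h u)^-1)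
    (- derive1 h u * ((h u)^-1 * (h u)^-1)).
Proof.
move=> sh hs; have ch : {for s, continuous h}.
  exact/derivable_continuous/(kderivable_derivable sh).
have nh : \forall u \near s, h u != 0.
  exact: (ch [set y | y != 0] (open_nbhs_nbhs (conj (@open_neq _ (0 : R)) hs))).
apply: filterS2 nh (kderivable_near sh) => u hu dh.
apply: DeriveDef; first exact: derivableV.
rewrite deriveV// derive1E /GRing.scale/= expr2 invfM mulNr.
by rewrite mulrC mulNr.
Qed.

Lemma kderivableV k (h : R -> R) s : kderivable k h s -> h s != 0 ->
  kderivable k (fun u => (h u)^-1) s.
Proof.
elim: k => [|k IH] sh hs; first by split.
have dV := near_derive1V sh hs.
apply/kderivableS; split; first by apply: filterS dV => u [].
apply: (@near_eq_kderivable _ _ _ ((cst (-1) \* derive1 h) \*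
    ((fun u => (h u)^-1) \* (fun u => (h u)^-1)))).
  by apply: filterS dV => u [_ Du]; rewrite derive1E Du /= mulN1r.
have sV := IH (kderivable_le (leqnSn k) sh) hs.
apply: kderivableM; last exact: kderivableM.
by apply: kderivableM; [exact: kderivable_cst|case/kderivableS: sh].
Qed.

Lemma expandsV (f : R -> R) c1 :
  expands f 1 c1 -> expands (fun e => (f e)^-1) 1 (-1 * c1).
Proof.
move=> ef; have d1 : is_derive (1 : R) (1 : R) (fun u : R => u^-1) (- 1).
  have n1 : (id (1 : R)) != 0 by exact: oner_neq0.
  have d1 : derivable (@id R) (1 : R) 1 by exact: derivable_id.
  apply: DeriveDef; first exact: derivableV n1 d1.
  by rewrite (deriveV n1 d1) derive_id /GRing.scale/= mulr1 expr1n invr1.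
by have := expands_comp d1 ef; rewrite /= invr1 mulrC.
Qed.

(** Since (1/f)' = - f' (1/f)^2, one derivative more of 1/f is a product of
    families that the induction hypothesis covers. The leading coefficient 1
    keeps f_e from vanishing around s for small e. *)
Lemma kexpandsV k f (f1 : R -> R) s : kexpands k f (cst 1) f1 s ->
  kexpands k (fun e u => (f e u)^-1) (cst 1) (cst (-1) \* f1) s.
Proof.
elim: k => [|k IH] Hf; have eV := expandsV (kexpands0 Hf).
  split; first by apply: filterE => e; split.
  - by split.
  - by split.
  - by move=> j; rewrite leqn0 => /eqP->; exact: eV.
have HVk := IH (kexpands_le (leqnSn k) Hf).
move: (Hf) => /kexpandsS[sf _ sf1 _ Hf'].
have fes : \forall e \near (0 : R)^', f e s != 0.
  apply: (expands_cvg (kexpands0 Hf) (t := [set y | y != 0])).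
  exact: (open_nbhs_nbhs (conj (@open_neq _ (0 : R)) (oner_neq0 R))).
apply/kexpandsS; split.
- by apply: filterS2 sf fes => e; exact: kderivableV.
- exact: kderivable_cst.
- by apply: kderivableM => //; exact: kderivable_cst.
- exact: eV.
- have sm1 : kderivable k (cst (-1 : R)) s by exact: kderivable_cst.
  have := kexpandsM (kexpandsM (kexpands_cst sm1) Hf') (kexpandsM HVk HVk).
  apply: near_eq_kexpands.
  + apply: filterS2 sf fes => e sfe fe0.
    apply: filterS (near_derive1V sfe fe0) => u [_ Du].
    by rewrite derive1E Du /= mulN1r.
  + by apply: filterE => u; rewrite /= !derive1_cst; ring.
  + have sm1' : kderivable k.+1 (cst (-1 : R)) s by exact: kderivable_cst.
    apply: filterS (near_derive1M sm1' sf1) => u ->.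
    by rewrite /= !derive1_cst; ring.
Qed.

End FamilyExpansion.

(** * The derivative of the current along a curve *)

Section DotProduct.
Context {R : realType} {n : nat}.
Implicit Types v w : 'cV[R]_n.

Lemma dotvDl (u v : 'cV[R]_n) w : dotv (u + v) w = dotv u w + dotv v w.
Proof. by rewrite /dotv -big_split/=; apply: eq_bigr => k _; rewrite mxE mulrDl. Qed.

Lemma dotvDr u v w : dotv w (u + v) = dotv w u + dotv w v.
Proof. by rewrite /dotv -big_split/=; apply: eq_bigr => k _; rewrite mxE mulrDr. Qed.

Lemma dotvZl c u v : dotv (c *: u) v = c * dotv u v.
Proof. by rewrite /dotv mulr_sumr; apply: eq_bigr => k _; rewrite mxE mulrA. Qed.

Lemma dotvZr c u v : dotv u (c *: v) = c * dotv u v.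
Proof. by rewrite /dotv mulr_sumr; apply: eq_bigr => k _; rewrite mxE mulrCA. Qed.

Lemma dotvBl u v w : dotv (u - v) w = dotv u w - dotv v w.
Proof. by rewrite -scaleN1r dotvDl dotvZl mulN1r. Qed.

Lemma dotvBr u v w : dotv w (u - v) = dotv w u - dotv w v.
Proof. by rewrite -scaleN1r dotvDr dotvZr mulN1r. Qed.

Lemma is_derive_coord (p r : nat) (M : R -> 'M[R]_(p, r)) (s : R) dM i j :
  is_derive s (1 : R) M dM -> is_derive s (1 : R) (fun x => M x i j) (dM i j).
Proof.
move=> [M1 <-]; apply: DeriveDef; first by move/derivable_mxP: M1.
by rewrite derive_mx// mxE.
Qed.

Lemma is_derive_dotv (f g : R -> 'cV[R]_n) (s : R) df dg :
  is_derive s (1 : R) f df -> is_derive s (1 : R) g dg ->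
  is_derive s (1 : R) (fun x => dotv (f x) (g x)) (dotv df (g s) + dotv (f s) dg).
Proof.
move=> Hf Hg; rewrite /dotv -big_split/=.
have H k : is_derive s (1 : R) (fun x => f x k ord0 * g x k ord0)
    (df k ord0 * g s k ord0 + f s k ord0 * dg k ord0).
  apply: is_derive_eq (is_deriveM (is_derive_coord k ord0 Hf)
    (is_derive_coord k ord0 Hg)) _.
  by rewrite /GRing.scale/= addrC [g s k ord0 * _]mulrC.
have := is_derive_sum H; apply: near_eq_is_derive.
by apply: filterE => u; rewrite fct_sumE.
Qed.

Lemma is_derive_sum_nat (W : normedModType R) (k : nat) (F : nat -> R -> W) (s : R) dF :
  (forall j, (j < k)%N -> is_derive s (1 : R) (F j) (dF j)) ->
  is_derive s (1 : R) (fun u => \sum_(0 <= j < k) F j u) (\sum_(0 <= j < k) dF j).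
Proof.
move=> H; rewrite big_mkord.
have := is_derive_sum (fun j : 'I_k => H j (ltn_ord j)); apply: near_eq_is_derive.
by apply: filterE => u; rewrite fct_sumE big_mkord.
Qed.

End DotProduct.

Section Telescope.
Context {R : realType} {n : nat}.

(** Summation by parts behind the current: with P = psi and g = grad L, the
    summand is g_j . r_j plus the increment of P_j . r_j. *)
Lemma telescope_dotv m (g P r : nat -> 'cV[R]_n) : P m = g m ->
  \sum_(0 <= j < m) (dotv (g j - P j) (r j) + dotv (P j.+1) (r j.+1)) =
  \sum_(0 <= j < m.+1) dotv (g j) (r j) - dotv (P 0%N) (r 0%N).
Proof.
move=> Pm.
rewrite (eq_bigr (fun j => dotv (g j) (r j) +
   (dotv (P j.+1) (r j.+1) - dotv (P j) (r j)))); last first.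
  by move=> j _; rewrite dotvBl; ring.
by rewrite big_split/= telescope_sumr// Pm big_nat_recr//= addrA.
Qed.

End Telescope.

Section AlongCurve.
Context {R : realType} {n m : nat}.
Variables (L : R * 'M[R]_(n, m.+1) -> R) (q : R -> 'cV[R]_n).
Variables (tau : R * 'cV[R]_n -> R) (xi : R * 'cV[R]_n -> 'cV[R]_n).
Variable s : R.
Hypothesis sq : kderivable m.*2 q s.
Hypothesis m_gt0 : (0 < m)%N.
Hypothesis CL : Ck_at m.*2 L (s, jet m.+1 q s).
Hypothesis Ctau : Ck_at m tau (s, q s).
Hypothesis Cxi : Ck_at m xi (s, q s).

Lemma kderivable_jet k l : (k + l <= m.*2.+1)%N -> kderivable l (jet k q) s.
Proof.
move=> kl; apply/kderivable_mxP => i j.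
rewrite (_ : (fun _ => _) = fun u => derive1n j q u i ord0); last first.
  by apply/funext => u; rewrite mxE.
have : kderivable l (derive1n j q) s.
  apply/kderivable_derive1n/(kderivable_le _ sq).
  by rewrite -ltnS (leq_trans _ kl)// -addSn leq_add2r.
by move/kderivable_mxP; apply.
Qed.

Lemma is_derive_jet k : (k <= m.*2)%N -> forall i j,
  is_derive s (1 : R) (fun u => jet k q u i j) (derive1n j.+1 q s i ord0).
Proof.
move=> km i j.
rewrite (_ : (fun _ => _) = fun u => derive1n j q u i ord0); last first.
  by apply/funext => u; rewrite mxE.
apply/is_derive_coord/is_derive_derive1n/(kderivable_le _ sq).
by rewrite (leq_trans _ km).
Qed.

Lemma gradL_coord i (p : R * 'M[R]_(n, m.+1)) k :
  gradL L i p k ord0 = partial_entry L k (inord i) p.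
Proof. by rewrite mxE. Qed.

Lemma sum_partial_entry (r : nat -> 'cV[R]_n) (p : R * 'M[R]_(n, m.+1)) :
  \sum_(i < n) \sum_(j < m.+1) r j i ord0 * partial_entry L i j p =
  \sum_(0 <= j < m.+1) dotv (gradL L j p) (r j).
Proof.
rewrite exchange_big/= big_mkord; apply: eq_bigr => j _; apply: eq_bigr => i _.
by rewrite gradL_coord inord_val mulrC.
Qed.

Lemma kderivable_gradLq i : kderivable m (gradLq L q i) s.
Proof.
apply/kderivable_mxP => k j; rewrite [j]ord1.
rewrite (_ : (fun _ => _) =
  fun u => partial_entry L k (inord i) (u, jet m.+1 q u)); last first.
  by apply/funext => u; rewrite gradL_coord.
apply: kderivable_comp; last by apply: kderivable_jet; rewrite addSn addnn.
have : Ck_at m.+1 L (s, jet m.+1 q s).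
  by apply: Ck_at_le CL; rewrite -addnn -addn1 leq_add2l.
by case=> _; exact.
Qed.

Lemma kderivable_q : kderivable m q s.
Proof. by apply: kderivable_le sq; rewrite -addnn leq_addr. Qed.

Lemma kderivable_tauq : kderivable m (tauq q tau) s.
Proof. exact: kderivable_comp Ctau kderivable_q. Qed.

Lemma kderivable_xiq : kderivable m (xiq q xi) s.
Proof. exact: kderivable_comp_mx Cxi kderivable_q. Qed.

Lemma is_derive_Lq : is_derive s (1 : R) (Lq L q)
  (partial_theta L (s, jet m.+1 q s) +
   \sum_(0 <= j < m.+1) dotv (gradLq L q j s) (derive1n j.+1 q s)).
Proof.
have dL : differentiable L (s, jet m.+1 q s).
  have : Ck_at 1 L (s, jet m.+1 q s).
    by apply: Ck_at_le CL; rewrite double_gt0.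
  by case=> /nbhs_singleton.
have jk : (m.+1 <= m.*2)%N by rewrite -addnn -addn1 leq_add2l.
apply: is_derive_eq (@is_derive_pair_mx _ _ _ L id (jet m.+1 q) s 1 _
  (is_derive_id _ _) (is_derive_jet jk) dL) _.
by rewrite mul1r (sum_partial_entry (fun j => derive1n j.+1 q s)).
Qed.

(** Differentiating psi^(j+1) shifts its alternating sum by one step, which is
    psi^j without its first term grad_j L. *)
Lemma is_derive_psi j : (j < m)%N ->
  is_derive s (1 : R) (psi L q j.+1) (gradLq L q j s - psi L q j s).
Proof.
move=> jm.
have H i : (i < (m - j.+1).+1)%N -> is_derive s (1 : R)
    (fun u => (-1) ^+ i *: derive1n i (gradLq L q (i + j.+1)) u)
    ((-1) ^+ i *: derive1n i.+1 (gradLq L q (i + j.+1)) s).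
  move=> im; apply/is_deriveZ/is_derive_derive1n/(kderivable_le _ (kderivable_gradLq _)).
  by rewrite (leq_trans im)// subnSK// leq_subr.
apply: is_derive_eq (is_derive_sum_nat H) _.
rewrite /psi [X in _ - X]big_nat_recl// expr0 scale1r add0n opprD addNKr subnSK//.
rewrite -sumrN; apply: eq_bigr => i _.
by rewrite exprS mulN1r scaleNr opprK addSnnS.
Qed.

Lemma psi0 : psi L q 0 s = EL_lhs L q s.
Proof. by rewrite /psi /EL_lhs subn0; apply: eq_bigr => i _; rewrite addn0. Qed.

Lemma psim : psi L q m s = gradLq L q m s.
Proof. by rewrite /psi subnn big_nat1 expr0 scale1r. Qed.

Lemma kderivable_rho j : (j <= m)%N -> kderivable (m - j) (rho q tau xi j) s.
Proof.
elim: j => [_|j IH jm]; first by rewrite subn0; exact: kderivable_xiq.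
have /kderivableS[_ sr] : kderivable (m - j.+1).+1 (rho q tau xi j) s.
  by rewrite subnSK//; exact/IH/ltnW.
apply/kderivable_mxP => i k; rewrite [k]ord1.
rewrite (_ : (fun _ => _) = (fun u => derive1 (rho q tau xi j) u i ord0) \+
  ((cst (-1) \* derive1 (tauq q tau)) \*
   (fun u => derive1n j.+1 q u i ord0))); last first.
  by apply/funext => u; rewrite /= !mxE/= mulN1r mulNr.
apply: kderivableD; first by move/kderivable_mxP: sr; apply.
apply: kderivableM; first apply: kderivableM; first exact: kderivable_cst.
  move: kderivable_tauq; rewrite -{1}(prednK m_gt0) => /kderivableS[_].
  by apply: kderivable_le; rewrite -ltnS prednK// ltn_subrL.
have : kderivable (m - j.+1) (derive1n j.+1 q) s.
  apply/kderivable_derive1n/(kderivable_le _ sq).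
  by rewrite subnKC// -addnn leq_addr.
by move/kderivable_mxP; apply.
Qed.

Lemma is_derive_rho j : (j < m)%N -> is_derive s (1 : R) (rho q tau xi j)
  (rho q tau xi j.+1 s + derive1 (tauq q tau) s *: derive1n j.+1 q s).
Proof.
move=> jm; apply: DeriveDef; last by rewrite /= subrK derive1E.
apply: (@kderivable_derivable _ _ 0); apply: kderivable_le (kderivable_rho (ltnW jm)).
by rewrite subn_gt0.
Qed.

Lemma is_derive_tauq : is_derive s (1 : R) (tauq q tau) (derive1 (tauq q tau) s).
Proof.
apply: DeriveDef; last by rewrite derive1E.
by apply: (@kderivable_derivable _ _ 0); apply: kderivable_le kderivable_tauq.
Qed.

(** [telescope_dotv] applies twice, with r_j = rho^j and r_j = q^(j+1). The
    boundary terms at j = 0 combine to E . (xi - tau q') = E . Omega; the terms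
    in tau' that come from rho^j' = rho^(j+1) + tau' q^(j+1) cancel those of
    the coefficient of tau in the current. *)
Lemma is_derive_noetherC (Lam : R * 'M[R]_(n, m.*2) -> R) :
  differentiable Lam (s, jet m.*2 q s) ->
  is_derive s (1 : R) (noetherC L q tau xi Lam)
   (partial_theta L (s, jet m.+1 q s) * tauq q tau s
    + \sum_(0 <= j < m.+1) dotv (gradLq L q j s) (rho q tau xi j s)
    + Lq L q s * derive1 (tauq q tau) s
    - derive1 (fun u => Lam (u, jet m.*2 q u)) s
    - dotv (EL_lhs L q s) (Omega q tau xi s)).
Proof.
move=> dLam.
have DLam : is_derive s (1 : R) (fun u => Lam (u, jet m.*2 q u))
    (derive1 (fun u => Lam (u, jet m.*2 q u)) s).
  have [D _] := @is_derive_pair_mx _ _ _ Lam id (jet m.*2 q) s 1 _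
    (is_derive_id _ _) (is_derive_jet (leqnn _)) dLam.
  by apply: DeriveDef; [exact: D|rewrite derive1E].
have Dq j (jm : (j < m)%N) : is_derive s (1 : R) (derive1n j.+1 q) (derive1n j.+2 q s).
  apply/is_derive_derive1n/(kderivable_le _ sq).
  by rewrite -addnn (@leq_trans (m + 1))// ?addn1// -addn1 leq_add2l.
pose B u := \sum_(0 <= j < m) dotv (psi L q j.+1 u) (derive1n j.+1 q u).
have parts r := @telescope_dotv _ _ m (gradLq L q ^~ s) (psi L q ^~ s) r psim.
have D1 : is_derive s (1 : R)
    (fun u => \sum_(0 <= j < m) dotv (psi L q j.+1 u) (rho q tau xi j u))
    (\sum_(0 <= j < m.+1) dotv (gradLq L q j s) (rho q tau xi j s)
     - dotv (EL_lhs L q s) (xiq q xi s) + derive1 (tauq q tau) s * B s).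
  apply: is_derive_eq (is_derive_sum_nat
    (fun j jm => is_derive_dotv (is_derive_psi jm) (is_derive_rho jm))) _.
  rewrite -psi0 -(parts (fun j => rho q tau xi j s)).
  rewrite mulr_sumr -big_split/=; apply: eq_bigr => j _.
  by rewrite dotvDr dotvZr addrA.
have D2 : is_derive s (1 : R) B
    (\sum_(0 <= j < m.+1) dotv (gradLq L q j s) (derive1n j.+1 q s)
     - dotv (EL_lhs L q s) (derive1 q s)).
  apply: is_derive_eq (is_derive_sum_nat
    (fun j jm => is_derive_dotv (is_derive_psi jm) (Dq j jm))) _.
  by rewrite -psi0 -(parts (fun j => derive1n j.+1 q s)).
have D := is_deriveB (is_deriveD D1
  (is_deriveM (is_deriveB is_derive_Lq D2) is_derive_tauq)) DLam.
apply: is_derive_eq; first apply: near_eq_is_derive D.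
  by apply: filterE => u; rewrite /noetherC !big_add1.
rewrite dotvBr dotvZr.
have -> : (Lq L q - B) s = Lq L q s - B s by [].
move: (\sum_(0 <= j < m.+1) _) (\sum_(0 <= j < m.+1) _) (B s) (Lq L q s).
move: (dotv _ (xiq q xi s)) (dotv _ (derive1 q s)) (derive1 (tauq q tau) s).
move: (derive1 _ s) (partial_theta _ _) (tauq _ _ _).
by move=> *; rewrite /GRing.scale/=; ring.
Qed.

End AlongCurve.

(** * The Euler-Lagrange force and the condition on the generators *)

Section EulerLagrangeForce.
Context {R : realType} {n m : nat}.
Variables (L : R * 'M[R]_(n, m.+1) -> R) (q : R -> 'cV[R]_n).

(** For alpha < 1 this is the functional equation of Gamma; at alpha = 1 the
    reading 1/Gamma(0) = 0 agrees with the factor 1 - alpha. *)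
Lemma invGamma_ratio (alpha : R) : alpha <= 1 ->
  (if alpha == 1 then 0 else (Gamma (1 - alpha))^-1) = (1 - alpha) / Gamma (2 - alpha).
Proof.
move=> alpha1; case: eqVneq => [->|an1]; first by rewrite subrr mul0r.
have a0 : 0 < 1 - alpha by rewrite subr_gt0 lt_neqAle an1.
have -> : 2 - alpha = (1 - alpha) + 1 by ring.
by rewrite GammaS// invfM mulVKf ?gt_eqF.
Qed.

(** Term by term, 1/Gamma(1 - alpha) = (1 - alpha)/Gamma(2 - alpha) supplies
    the factor 1 - alpha, and the powers of t - s differ by one. *)
Lemma EL_F_cond_G (alpha t s : R) : alpha <= 1 -> s < t ->
  EL_F L q alpha t s = ((1 - alpha) / (t - s)) *: cond_G L q alpha t s.
Proof.
move=> alpha1 st; have ts : t - s != 0 by rewrite subr_eq0 gt_eqF.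
rewrite /EL_F /cond_G scalerDr invGamma_ratio//; congr (_ + _).
  by congr (_ *: _); apply: eq_bigr => i _; rewrite mulrC.
rewrite scaler_sumr; apply: eq_bigr => k _; rewrite scaler_sumr.
rewrite big_nat_cond [RHS]big_nat_cond; apply: eq_bigr => i /andP[/andP[i2 _] _].
rewrite scalerA; congr (_ *: _); rewrite !mulrA; congr (_ * _).
have -> : (t - s) ^+ i = (t - s) * (t - s) ^+ i.-1 by rewrite -exprS prednK// ltnW.
by rewrite !invfM; ring.
Qed.

End EulerLagrangeForce.

(** * The infinitesimal form of invariance *)

Lemma is_o_coord (R : realType) (p r : nat) (D : set R) (M : R -> 'M[R]_(p, r)) i j :
  is_o_eps D M -> is_o_eps D (fun e => M e i j).
Proof.
rewrite /is_o_eps => /eqoP Mo; apply/eqoP => eps eps0.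
apply: filterS (Mo eps eps0) => e; apply: le_trans.
rewrite [leRHS]/Num.Def.normr/= mx_normrE.
exact: (le_bigmax _ _ (i, j)).
Qed.

Section Invariance.
Context {R : realType} {n m : nat}.
Variables (L : R * 'M[R]_(n, m.+1) -> R) (q : R -> 'cV[R]_n).
Variables (tau : R * 'cV[R]_n -> R) (xi : R * 'cV[R]_n -> 'cV[R]_n).
Variables (thb : R -> R * 'cV[R]_n -> R) (qb : R -> R * 'cV[R]_n -> 'cV[R]_n).
Variable s : R.
Hypothesis m_gt0 : (0 < m)%N.
Hypothesis sq : kderivable m.*2 q s.
Hypothesis stau : kderivable m (tauq q tau) s.
Hypothesis sxi : kderivable m (xiq q xi) s.
Hypothesis th_Ck : \forall e \near (0 : R)^', Ck_at m (rem_th thb tau q e) s.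
Hypothesis q_Ck : \forall e \near (0 : R)^', Ck_at m (rem_q qb xi q e) s.
Hypothesis th_o : forall k, (k <= m)%N ->
  is_o_eps setT (fun e : R => derive1n k (rem_th thb tau q e) s).
Hypothesis q_o : forall k, (k <= m)%N ->
  is_o_eps setT (fun e : R => derive1n k (rem_q qb xi q e) s).

Lemma kexpands_affine k (f0 f1 : R -> R) (r : R -> R -> R) :
  kderivable k f0 s -> kderivable k f1 s -> kexpands k r (cst 0) (cst 0) s ->
  kexpands k (fun e u => f0 u + e * f1 u + r e u) f0 f1 s.
Proof.
move=> s0 s1 hr.
have H := kexpandsD (kexpandsD (kexpands_cst s0)
  (kexpandsM (kexpands_eps k s) (kexpands_cst s1))) hr.
apply: near_eq_kexpands H.
- by apply: filterE => e; apply: filterE.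
- by apply: filterE => u /=; ring.
- by apply: filterE => u /=; ring.
Qed.

Lemma kexpands_thbq : kexpands m (thbq thb q) id (tauq q tau) s.
Proof.
have hr : kexpands m (rem_th thb tau q) (cst 0) (cst 0) s.
  apply: kexpands_o => [|j jm]; last first.
    by apply: is_o_expands (th_o jm) _; exact: filterE.
  by apply: filterS th_Ck => e; exact: Ck_at_kderivable.
apply: near_eq_kexpands (kexpands_affine (kderivable_id m s) stau hr).
- apply: filterE => e; apply: filterE => u.
  by rewrite /rem_th /tauq /= addrC subrK.
- exact: filterE.
- exact: filterE.
Qed.

Lemma kexpands_qbq i :
  kexpands m (fun e u => qbq qb q e u i ord0) (fun u => q u i ord0)
    (fun u => xiq q xi u i ord0) s.
Proof.
have hr : kexpands m (fun e u => rem_q qb xi q e u i ord0) (cst 0) (cst 0) s.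
  apply: kexpands_o => [|j jm].
    by apply: filterS q_Ck => e /Ck_at_kderivable/kderivable_mxP; exact.
  have /is_o_expands/(_ (filterE _ _)) : is_o_eps setT
      (fun e => derive1n j (rem_q qb xi q e) s i ord0).
    exact: is_o_coord (q_o jm).
  move=> /(_ (fun _ => I)); apply: near_eq_expands.
  apply: filterS q_Ck => e /Ck_at_kderivable/(kderivable_le jm) H.
  exact: nbhs_singleton (near_derive1n_mx H i ord0).
have sqi : kderivable m (fun u => q u i ord0) s.
  apply/(kderivable_mxP m q s).1/(kderivable_le _ sq).
  by rewrite -addnn leq_addr.
apply: near_eq_kexpands (kexpands_affine sqi ((kderivable_mxP _ _ _).1 sxi i ord0) hr).
- apply: filterE => e; apply: filterE => u.
  by rewrite /rem_q /xiq !mxE; ring.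
- exact: filterE.
- exact: filterE.
Qed.

(** Inverting d thetabar/d theta = 1 + e tau' gives 1 - e tau', and
    (1 - e tau')(q^(j+1) + e rho^j') has e-coefficient rho^j' - tau' q^(j+1) =
    rho^(j+1). Each step consumes one theta-derivative. *)
Lemma kexpands_dqb j i : (j <= m)%N ->
  kexpands (m - j) (fun e u => dqb thb qb q e j u i ord0)
    (fun u => derive1n j q u i ord0) (fun u => rho q tau xi j u i ord0) s.
Proof.
elim: j i => [|j IH] i jm; first by rewrite subn0; exact: kexpands_qbq.
have jm' := ltnW jm.
have IHS k : kexpands (m - j.+1).+1 (fun e u => dqb thb qb q e j u k ord0)
    (fun u => derive1n j q u k ord0) (fun u => rho q tau xi j u k ord0) s.
  by rewrite subnSK//; exact: IH.
have /kexpandsS[_ _ _ _ H'] := IHS i.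
have HT : kexpands (m - j.+1) (fun e => derive1 (thbq thb q e)) (cst 1)
    (derive1 (tauq q tau)) s.
  have : kexpands m.-1.+1 (thbq thb q) id (tauq q tau) s.
    by rewrite prednK//; exact: kexpands_thbq.
  move=> /kexpandsS[_ _ _ _ HT].
  have jm1 : (m - j.+1 <= m.-1)%N by rewrite -ltnS prednK// ltn_subrL.
  apply: near_eq_kexpands (kexpands_le jm1 HT).
  - by apply: filterE => e; exact: filterE.
  - by apply: filterE => u; rewrite derive1E derive_id.
  - exact: filterE.
apply: near_eq_kexpands (kexpandsM (kexpandsV HT) H').
- have sv : \forall e \near (0 : R)^', kderivable 1 (dqb thb qb q e j) s.
    have : \forall e \near (0 : R)^', forall k : 'I_n,
        kderivable 1 (fun u => dqb thb qb q e j u k ord0) s.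
      apply: (@filter_forall _ _ (fun k => [set e | kderivable 1
        (fun u => dqb thb qb q e j u k ord0) s])) => k.
      by have [H _ _ _] := IHS k; apply: filterS H => e; exact: kderivable_le.
    by apply: filterS => e He; apply/kderivable_mxP => k l; rewrite [l]ord1.
  apply: filterS sv => e sv.
  apply: filterS (near_derive1_mx (kderivable_near sv) i ord0) => u /= <-.
  by rewrite mxE.
- have : kderivable 1 (derive1n j q) s.
    apply/kderivable_derive1n/(kderivable_le _ sq).
    by rewrite addn1 -addnn (leq_trans jm)// leq_addr.
  move=> /kderivable_near/near_derive1_mx/(_ i ord0); apply: filterS => u /= <-.
  by rewrite mul1r.
- have sq1 : kderivable 1 (derive1n j q) s.
    apply/kderivable_derive1n/(kderivable_le _ sq).
    by rewrite addn1 -addnn (leq_trans jm)// leq_addr.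
  have sr1 : kderivable 1 (rho q tau xi j) s.
    apply/kderivable_mxP => k l; rewrite [l]ord1.
    by have [_ _ H _] := IHS k; apply: kderivable_le H.
  have Dq := near_derive1_mx (kderivable_near sq1) i ord0.
  have Dr := near_derive1_mx (kderivable_near sr1) i ord0.
  apply: filterS2 Dq Dr => u /= <- <-.
  by rewrite !mxE /= mul1r mulN1r mulNr.
Qed.

Variables (a t alpha : R) (Lam : R * 'M[R]_(n, m.*2) -> R).
Hypothesis s_at : a < s < t.
Hypothesis dL : differentiable L (s, jet m.+1 q s).
Hypothesis inv_s : is_o_eps [set e | a <= thbq thb q e s < t] (fun e : R =>
     L (thbq thb q e s, jet_bar thb qb m q e s) * (t - thbq thb q e s) `^ (alpha - 1)
       * derive1 (thbq thb q e) s
     - (Lq L q s * (t - s) `^ (alpha - 1)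
        + e * (t - s) `^ (alpha - 1)
          * derive1 (fun u => Lam (u, jet m.*2 q u)) s)).

(** Both sides of the invariance identity expand in e; their e-coefficients
    agree, and (t - s)^(alpha - 1) is a nonzero common factor. *)
Lemma infinitesimal_invariance :
  partial_theta L (s, jet m.+1 q s) * tauq q tau s
  + \sum_(0 <= j < m.+1) dotv (gradLq L q j s) (rho q tau xi j s)
  + Lq L q s * derive1 (tauq q tau) s
  + (1 - alpha) / (t - s) * (Lq L q s * tauq q tau s)
  = derive1 (fun u => Lam (u, jet m.*2 q u)) s.
Proof.
case/andP: s_at => as_ st; have ts0 : 0 < t - s by rewrite subr_gt0.
have Eth : expands (fun e => thbq thb q e s) s (tauq q tau s).
  exact: kexpands0 kexpands_thbq.
have Eth' : expands (fun e => derive1 (thbq thb q e) s) 1 (derive1 (tauq q tau) s).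
  have [_ _ _ /(_ 1%N m_gt0)] := kexpands_thbq.
  by rewrite [derive1n 1 id s]derive1E derive_id.
(* Here s must be interior: thetabar tends to s, so it ends up in [a, t). *)
have near_at : \forall e \near (0 : R)^', a <= thbq thb q e s < t.
  apply: (expands_cvg Eth (t := [set u | a <= u < t])).
  by apply: filterS2 (lt_nbhsr as_) (lt_nbhsl st) => u /= /ltW -> ->.
have EL : expands (fun e => L (thbq thb q e s, jet_bar thb qb m q e s)) (Lq L q s)
    (tauq q tau s * partial_theta L (s, jet m.+1 q s) +
     \sum_(0 <= j < m.+1) dotv (gradLq L q j s) (rho q tau xi j s)).
  have EM i j : expands (fun e => jet_bar thb qb m q e s i j) (jet m.+1 q s i j)
     ((\matrix_(r < n, k < m.+1) rho q tau xi k s r ord0) i j).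
    rewrite !mxE; have jm : (j <= m)%N by rewrite -ltnS.
    apply: near_eq_expands (kexpands0 (kexpands_dqb i jm)).
    by apply: filterE => e; rewrite mxE.
  have := expands_pair_mx Eth EM dL.
  rewrite (eq_bigr (fun i => \sum_(j < m.+1) rho q tau xi j s i ord0 *
    partial_entry L i j (s, jet m.+1 q s)))
    ?(sum_partial_entry L (fun j => rho q tau xi j s))//.
  by move=> i _; apply: eq_bigr => j _; rewrite mxE.
have EW : expands (fun e => (t - thbq thb q e s) `^ (alpha - 1)) ((t - s) `^ (alpha - 1))
    (- tauq q tau s * ((alpha - 1) * (t - s) `^ (alpha - 1 - 1))).
  have E1 := expandsD (expands_cst t) (expandsM (expands_cst (-1)) Eth).
  have E2 : expands (fun e => t - thbq thb q e s) (t - s) (- tauq q tau s).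
    have -> : t - s = t + -1 * s by rewrite mulN1r.
    have -> : - tauq q tau s = 0 + (-1 * tauq q tau s + 0 * s) by ring.
    by apply: near_eq_expands E1; apply: filterE => e; rewrite /= mulN1r.
  exact: expands_comp (is_derive1_powR (alpha - 1) ts0) E2.
have E := expandsM (expandsM EL EW) Eth'.
have E' : expands (fun e => L (thbq thb q e s, jet_bar thb qb m q e s) *
    (t - thbq thb q e s) `^ (alpha - 1) * derive1 (thbq thb q e) s)
    (Lq L q s * (t - s) `^ (alpha - 1) * 1)
    ((t - s) `^ (alpha - 1) * derive1 (fun u => Lam (u, jet m.*2 q u)) s).
  have E0 := is_o_expands inv_s near_at.
  have E1 := expandsD (expands_cst (Lq L q s * (t - s) `^ (alpha - 1)))
   (expandsM expands_id (expands_cst ((t - s) `^ (alpha - 1) *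
     derive1 (fun u => Lam (u, jet m.*2 q u)) s))).
  have := expandsD E0 E1.
  rewrite !mul0r !add0r !addr0 !mul1r mulr1; apply: near_eq_expands.
  by apply: filterE => e /=; ring.
have := expands_unique E E'.
have w0 : (t - s) `^ (alpha - 1) != 0 by rewrite gt_eqF// powR_gt0.
have -> : (t - s) `^ (alpha - 1 - 1) = (t - s) `^ (alpha - 1) / (t - s).
  by rewrite powRB ?powRr1 ?ltW//; apply/implyP => _; rewrite gt_eqF.
move=> H; apply: (mulfI w0); rewrite -H.
by field; rewrite gt_eqF.
Qed.

End Invariance.

(** * Conservation *)

(** The derivative at a is also the limit of the right difference quotients,
    all of which vanish by the mean value theorem. *)
Lemma is_derive_left_endpoint (R : realType) (C : R -> R) (a t : R) : a < t ->
  derivable C a 1 -> (forall s, a < s < t -> is_derive s (1 : R) C 0) ->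
  is_derive a (1 : R) C 0.
Proof.
move=> at_ Ca C0; apply: DeriveDef => //.
rewrite -derive1E /derive1.
have Ca' : cvg (h^-1 *: (C (h + a) - C a) @[h --> 0^']).
  rewrite (_ : (fun _ => _) =
    (fun h : R => h^-1 *: ((C \o shift a) (h *: (1 : R)) - C a))); first exact: Ca.
  by apply/funext => h; rewrite /= [h *: _]mulr1.
rewrite cvg_at_rightE//; apply: cvg_lim => //.
apply: cvg_near_cst; near=> h.
have h0 : 0 < h by near: h; exact: nbhs_right_gt.
have hat : a < h + a by rewrite ltrDr.
have hat' : h + a < t.
  by rewrite -ltrBrDr; near: h; apply: nbhs_right_lt; rewrite subr_gt0.
have [||c _ ->] := @MVT _ C (cst 0) a (h + a) hat.
- move=> x; rewrite in_itv/= => /andP[ax xh]; apply: C0.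
  by rewrite ax (lt_trans xh).
- apply: derivable_within_continuous => x; rewrite in_itv/= => /andP[].
  rewrite le_eqVlt => /orP[/eqP <- _|ax xh]; first exact: Ca.
  have xat : a < x < t by rewrite ax (le_lt_trans xh).
  exact: (@ex_derive _ _ _ _ _ _ _ (C0 x xat)).
by rewrite mul0r scaler0.
Unshelve. all: by end_near. Qed.

Unset Implicit Arguments.
Set Strict Implicit.

Theorem theorem3p6 (R : realType) (n m : nat) (a b t alpha : R)
  (L : R * 'M[R]_(n, m.+1) -> R)
  (Lam : R * 'M[R]_(n, m.*2) -> R)
  (tau : R * 'cV[R]_n -> R) (xi : R * 'cV[R]_n -> 'cV[R]_n)
  (thb : R -> R * 'cV[R]_n -> R) (qb : R -> R * 'cV[R]_n -> 'cV[R]_n)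
  (n_ge1 : (1 <= n)%N) (m_ge1 : (1 <= m)%N)
  (lt_at : a < t) (le_tb : t <= b)
  (alpha_gt0 : 0 < alpha) (alpha_le1 : alpha <= 1)
  (L_C2m : forall p : R * 'M[R]_(n, m.+1), a <= p.1 <= b -> Ck_at m.*2 L p)
  (Lam_diff : forall p : R * 'M[R]_(n, m.*2), a <= p.1 < t -> differentiable Lam p)
  (tau_Cm : forall p : R * 'cV[R]_n, a <= p.1 <= b -> Ck_at m tau p)
  (xi_Cm : forall p : R * 'cV[R]_n, a <= p.1 <= b -> Ck_at m xi p)
  (generators : has_generators thb qb m a b t tau xi)
  (invariance : gauge_invariant thb qb L Lam a b t alpha)
  (G_condition : forall q : R -> 'cV[R]_n, curve_C m.*2 a b q ->
     forall s, a <= s < t ->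
     dotv (cond_G L q alpha t s) (Omega q tau xi s) = - (Lq L q s * tauq q tau s)) :
  forall q : R -> 'cV[R]_n, curve_C m.*2 a b q ->
  (forall s, a <= s < t -> EL_lhs L q s = EL_F L q alpha t s) ->
  forall s, a <= s < t -> is_derive s (1 : R) (noetherC L q tau xi Lam) (0 : R).
Proof.
move=> q qC EL.
have atb s : a <= s < t -> a <= s <= b.
  by case/andP=> -> st; rewrite (le_trans (ltW st)).
have sq s : a <= s < t -> kderivable m.*2 q s.
  by move=> /atb/qC; exact: Ck_at_kderivable.
have CL s : a <= s < t -> Ck_at m.*2 L (s, jet m.+1 q s).
  by move=> /atb; apply: (L_C2m (s, jet m.+1 q s)).
have Ctau s : a <= s < t -> Ck_at m tau (s, q s).
  by move=> /atb; apply: (tau_Cm (s, q s)).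
have Cxi s : a <= s < t -> Ck_at m xi (s, q s).
  by move=> /atb; apply: (xi_Cm (s, q s)).
have dC s (sat : a <= s < t) :=
  is_derive_noetherC (sq s sat) m_ge1 (CL s sat) (Ctau s sat) (Cxi s sat)
    (Lam_diff (s, jet m.*2 q s) sat).
have dC0 s : a < s < t -> is_derive s (1 : R) (noetherC L q tau xi Lam) 0.
  move=> /andP[as_ st]; have sat : a <= s < t by rewrite ltW.
  apply: is_derive_eq (dC s sat) _.
  have [thS qS thO qO] := generators q qC s sat.
  have dL : differentiable L (s, jet m.+1 q s).
    have : Ck_at 1 L (s, jet m.+1 q s) by apply: Ck_at_le (CL s sat); rewrite double_gt0.
    by case=> /nbhs_singleton.
  have Hinv := @infinitesimal_invariance _ _ _ L q tau xi thb qb s m_ge1 (sq s sat)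
    (kderivable_tauq (sq s sat) (Ctau s sat)) (kderivable_xiq (sq s sat) (Cxi s sat))
    thS qS thO qO a t alpha Lam.
  rewrite -Hinv; [|by rewrite as_|exact: dL|exact: (invariance q qC s sat)].
  (* Along a solution, E . Omega is the weight term of Hinv up to sign. *)
  rewrite (EL s sat) EL_F_cond_G// dotvZl (G_condition q qC s sat).
  move: (_ / _) (\sum_(0 <= j < m.+1) _) (partial_theta _ _) (derive1 _ _).
  move: (Lq _ _ _) (tauq _ _ _).
  by move=> *; ring.
move=> s sat; have [sa|sa] := eqVneq s a; last first.
  by apply: dC0; case/andP: sat => as_ ->; rewrite lt_neqAle eq_sym sa as_.
rewrite sa; apply: (is_derive_left_endpoint lt_at) => //.
by apply: ex_derive; apply: dC; rewrite lexx.
Qed.
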